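(* Let $M$ be a sub-Riemannian manifold with Carnot–Carathéodory distance $d$ and $L:\mathcal D\to\mathbb R$ a Lagrangian which is $C^2$, uniformly superlinear, uniformly bounded and strictly convex (in the sense of the context). Then the discounted value function $u_\lambda$ is Lipschitz for the metric $d$, uniformly in $\lambda>0$; that is, there is a constant $K$ such that $|u_\lambda(x)-u_\lambda(y)|\le K\,d(x,y)$ for all $x,y\in M$ and all $\lambda>0$.
   Context: $(M,\mathcal D,\langle\cdot,\cdot\rangle)$ is a sub-Riemannian manifold: $M$ is a connected smooth manifold, $\mathcal D\subset TM$ is a smooth bracket-generating distribution with a smoothly varying inner product and norm $\|\cdot\|$ on its fibers. A continuous curve $\gamma:[a,b]\to M$ is absolutely continuous if $\varphi\circ\gamma$ is absolutely continuous for every smooth compactly supported $\varphi:M\to\mathbb R$; it is horizontal if $\dot\gamma(t)\in\mathcal D$ for a.e. $t$. $W^{1,1}_{\mathcal D}([a,b])$ is the set of horizontal absolutely continuous curves on $[a,b]$; for an unbounded interval the condition is required on each compact subinterval. $d(x,y)$ is the infimum of the lengths $\int_a^b\|\dot\gamma\|\,dt$ of horizontal curves from $x$ to $y$. The Lagrangian $L:\mathcal D\to\mathbb R$ is $C^2$ and satisfies: (uniform superlinearity) for all $K\ge 0$ there is $C(K)\in\mathbb R$ with $L(v)\ge K\|v\|+C(K)$ for all $v\in\mathcal D$; (uniform boundedness) for all $R\ge 0$, $A(R)=\sup\{L(v):\|v\|\le R\}<+\infty$; (strict convexity) there is $a_0>0$ with $\partial^2_{vv}L(v)(w,w)\ge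 a_0$ for all $v,w\in\mathcal D$ in the same fiber with $\|w\|=1$. $u_\lambda(x)=\inf\int_{-\infty}^0e^{\lambda t}L(\dot\gamma(t))\,dt$ over $\gamma\in W^{1,1}_{\mathcal D}(]-\infty,0])$ with $\gamma(0)=x$. *)

(* Defs.v *)
From HB Require Import structures.
From mathcomp Require Import all_boot all_order all_algebra.
From mathcomp Require Import all_classical all_reals all_analysis.
Import Order.TTheory GRing.Theory Num.Theory.
Import numFieldNormedType.Exports.

Set Implicit Arguments.
Unset Strict Implicit.
Unset Printing Implicit Defensive.

Local Open Scope classical_set_scope.
Local Open Scope ring_scope.

(* C^k on the open set U, through existence and continuity of the iterated
   partial derivatives. *)
Fixpoint Ck (R : realType) (m k : nat) (U : set 'rV[R]_m) (f : 'rV[R]_m -> R)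
    {struct k} : Prop :=
  {within U, continuous f} /\
  (if k is k'.+1 then
     forall i : 'I_m,
       (forall q, U q -> derivable f q (delta_mx 0 i)) /\
       Ck k' U (fun q => derive f q (delta_mx 0 i))
   else True).

Definition smooth_on (R : realType) (m : nat) (U : set 'rV[R]_m)
    (f : 'rV[R]_m -> R) : Prop := forall k, Ck k U f.

(* A chart is a homeomorphism between the open set cdom and the open set
   cimg; cmap and cinv are irrelevant outside of these sets. *)
Record chart (R : realType) (n : nat) (T : topologicalType) := Chart {
  cdom : set T ;
  cmap : T -> 'rV[R]_n ;
  cinv : 'rV[R]_n -> T ;
  cdom_open : open cdom ;
  cimg_open : open (cmap @` cdom) ;
  cmapK : {in cdom, cancel cmap cinv} ;
  cmap_continuous : {within cdom, continuous cmap} ;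
  cinv_continuous : {within cmap @` cdom, continuous cinv} }.

(* chart_at picks, at each point, the chart in which tangent vectors at that
   point are written down. *)
Record smoothManifold (R : realType) (n : nat) := SmoothManifold {
  mspace :> topologicalType ;
  atlas : set (chart R n mspace) ;
  chart_at : mspace -> chart R n mspace ;
  mspace_hausdorff : hausdorff_space mspace ;
  mspace_second_countable : @second_countable mspace ;
  chart_atP : forall x, atlas (chart_at x) ;
  chart_at_dom : forall x, cdom (chart_at x) x ;
  atlas_smooth : forall c c', atlas c -> atlas c' -> forall i : 'I_n,
    smooth_on (cmap c @` (cdom c `&` cdom c'))
              (fun q => cmap c' (cinv c q) 0 i) }.

Section Manifold.
Variables (R : realType) (n : nat) (M : smoothManifold R n).

(* T_x M, a vector being represented by its components in chart_at M x. *)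
Definition tangent (x : M) : Type := 'rV[R]_n.

Definition vfield : Type := forall x : M, tangent x.

Definition smooth_fun (U : set M) (f : M -> R) : Prop :=
  forall c, atlas c ->
    smooth_on (cmap c @` (cdom c `&` U)) (fun q => f (cinv c q)).

(* Components of v in an arbitrary chart c around x: the differential of the
   transition map from chart_at M x to c, applied to v. *)
Definition tcoord (c : chart R n M) (x : M) (v : tangent x) : 'rV[R]_n :=
  derive (cmap c \o cinv (chart_at x)) (cmap (chart_at x) x) (v : 'rV[R]_n).

Definition vf_coord (c : chart R n M) (X : vfield) (q : 'rV[R]_n) :
  'rV[R]_n := tcoord c (X (cinv c q)).

Definition smooth_vf (U : set M) (X : vfield) : Prop :=
  forall c, atlas c -> forall i : 'I_n,
    smooth_on (cmap c @` (cdom c `&` U)) (fun q => vf_coord c X q 0 i).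

(* [X, Y] = dY(X) - dX(Y) in coordinates, evaluated at x in chart_at M x. *)
Definition lie_bracket (X Y : vfield) : vfield := fun x =>
  let c := chart_at x in
  (derive (vf_coord c Y) (cmap c x) (X x : 'rV[R]_n)
   - derive (vf_coord c X) (cmap c x) (Y x : 'rV[R]_n) : 'rV[R]_n).

(* The Lie algebra of vector fields generated by the smooth sections of D. *)
Inductive lie_hull (D : forall x : M, set (tangent x)) : vfield -> Prop :=
| lie_hull_section X : smooth_vf setT X -> (forall x, D x (X x)) ->
    lie_hull D X
| lie_hullD X Y : lie_hull D X -> lie_hull D Y ->
    lie_hull D (fun x => X x + Y x)
| lie_hullZ (a : R) X : lie_hull D X -> lie_hull D (fun x => a *: X x)
| lie_hull_bracket X Y : lie_hull D X -> lie_hull D Y ->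
    lie_hull D (lie_bracket X Y).

Definition bracket_generating (D : forall x : M, set (tangent x)) : Prop :=
  forall (x : M) (v : tangent x), exists2 X, lie_hull D X & X x = v.

Definition frame_mx (k : nat) (X : 'I_k -> vfield) (x : M) : 'M[R]_(k, n) :=
  \matrix_(i < k) (X i x : 'rV[R]_n).

(* X_1, ..., X_k are smooth on U and form a basis of D at each point of U. *)
Definition local_frame (D : forall x : M, set (tangent x)) (k : nat)
    (U : set M) (X : 'I_k -> vfield) : Prop :=
  [/\ open U,
      forall i, smooth_vf U (X i),
      forall x, U x -> row_free (frame_mx X x) &
      forall x, U x ->
        D x = [set v : tangent x | ((v : 'rV[R]_n) <= frame_mx X x)%MS]].

End Manifold.

(* The values of inner outside of the fibers of distr are irrelevant. *)
Record subRiemannian (R : realType) (n : nat) (M : smoothManifold R n) :=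
  SubRiemannian {
  rank : nat ;
  distr : forall x : M, set (tangent x) ;
  inner : forall x : M, tangent x -> tangent x -> R ;
  space_connected : connected [set: M] ;
  distr_smooth : forall x : M, exists (U : set M) (X : 'I_rank -> vfield M),
    U x /\ local_frame distr U X ;
  distr_bracket_generating : bracket_generating distr ;
  inner_linear : forall (x : M) (a : R) (u v w : tangent x),
    distr u -> distr v -> distr w ->
    inner (a *: u + v) w = a * inner u w + inner v w ;
  inner_sym : forall (x : M) (u v : tangent x),
    distr u -> distr v -> inner u v = inner v u ;
  inner_pos : forall (x : M) (v : tangent x),
    distr v -> v != 0 -> 0 < inner v v ;
  inner_smooth : forall (U : set M) (X Y : vfield M), open U ->
    smooth_vf U X -> smooth_vf U Y ->
    (forall x, U x -> distr (X x)) -> (forall x, U x -> distr (Y x)) ->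
    smooth_fun U (fun x => inner (X x) (Y x)) }.

Section SubRiemannian.
Variables (R : realType) (n : nat) (M : smoothManifold R n).
Variable S : subRiemannian M.

Definition hnorm (x : M) (v : tangent x) : R := Num.sqrt (inner S v v).

Definition abs_continuous (a b : R) (f : R -> R) : Prop :=
  forall e : R, 0 < e -> exists2 d : R, 0 < d &
    forall (m : nat) (s t : 'I_m -> R),
      (forall i, [/\ a <= s i, s i <= t i & t i <= b]) ->
      trivIset [set: 'I_m] (fun i => `]s i, t i[%classic) ->
      \sum_(i < m) (t i - s i) < d ->
      \sum_(i < m) `|f (t i) - f (s i)| < e.

(* Curves on an interval are represented by total functions of which only the
   values on the interval matter. *)
Definition ac_curve (a b : R) (g : R -> M) : Prop :=
  {within `[a, b], continuous g} /\
  forall phi : M -> R, smooth_fun setT phi ->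
    compact (closure [set x | phi x != 0]) ->
    abs_continuous a b (phi \o g).

Definition has_velocity (g : R -> M) (t : R) : Prop :=
  derivable (fun s => cmap (chart_at (g t)) (g s)) t 1.

Definition velocity (g : R -> M) (t : R) : tangent (g t) :=
  derive1 (fun s => cmap (chart_at (g t)) (g s)) t.

Definition horizontal (a b : R) (g : R -> M) : Prop :=
  {ae @lebesgue_measure R, forall t, `[a, b]%classic t ->
     has_velocity g t /\ distr S (velocity g t)}.

Definition W11 (a b : R) (g : R -> M) : Prop :=
  ac_curve a b g /\ horizontal a b g.

Definition W11_neg (g : R -> M) : Prop :=
  forall a b : R, a <= b -> b <= 0 -> W11 a b g.

Definition curve_length (a b : R) (g : R -> M) : \bar R :=
  (\int[@lebesgue_measure R]_(t in `[a, b]) (hnorm (velocity g t))%:E)%E.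

Definition cc_dist (x y : M) : \bar R :=
  ereal_inf [set l | exists (a b : R) (g : R -> M),
    [/\ a <= b, W11 a b g, g a = x, g b = y & l = curve_length a b g]].

(* A Lagrangian is given by a function of all tangent vectors, of which only
   the values on the distribution matter. *)
Definition lagrangian : Type := forall x : M, tangent x -> R.

(* L is C^2 in the local trivializations (q, a) |-> sum_i a_i X_i(q) of the
   vector bundle distr S; z packs the coordinates (q, a). *)
Definition lagrangian_C2 (L : lagrangian) : Prop :=
  forall (U : set M) (X : 'I_(rank S) -> vfield M) (c : chart R n M),
    local_frame (distr S) U X -> atlas c ->
    Ck 2 [set z : 'rV[R]_(n + rank S) |
           (cmap c @` (cdom c `&` U)) (lsubmx z)]
      (fun z => L (cinv c (lsubmx z))
                  (\sum_(i < rank S) rsubmx z 0 i *: X i (cinv c (lsubmx z)))).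

Definition uniformly_superlinear (L : lagrangian) : Prop :=
  forall K : R, 0 <= K -> exists C : R,
    forall (x : M) (v : tangent x), distr S v -> K * hnorm v + C <= L x v.

Definition uniformly_bounded (L : lagrangian) : Prop :=
  forall r : R, 0 <= r ->
    (ereal_sup [set l | exists (x : M) (v : tangent x),
       [/\ distr S v, (hnorm v <= r)%R & l = (L x v)%:E]] < +oo)%E.

(* The fiberwise Hessian of L at v applied to (w, w'). For v, w, w' in the
   distribution it only depends on the values of L there. *)
Definition fiber_hessian (L : lagrangian) (x : M) (v w w' : tangent x) : R :=
  derive (fun u : 'rV[R]_n => derive (L x : 'rV[R]_n -> R) u (w' : 'rV[R]_n))
    (v : 'rV[R]_n) (w : 'rV[R]_n).

Definition strictly_convex (L : lagrangian) : Prop :=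
  exists2 a0 : R, 0 < a0 &
    forall (x : M) (v w : tangent x), distr S v -> distr S w ->
      hnorm w = 1 -> a0 <= fiber_hessian L v w w.

Definition value_function (L : lagrangian) (lambda : R) (x : M) : \bar R :=
  ereal_inf [set l | exists g : R -> M,
    [/\ W11_neg g, g 0 = x &
        l = (\int[@lebesgue_measure R]_(t in `]-oo, 0%R])
               (expR (lambda * t) * L (g t) (velocity g t))%:E)%E]].

End SubRiemannian.

(* Main.v *)
Require Import Defs.
From HB Require Import structures.
From mathcomp Require Import all_boot all_order all_algebra.
From mathcomp Require Import all_classical all_reals all_analysis.
From mathcomp Require Import measurable_realfun ring lra.
Import Order.TTheory GRing.Theory Num.Theory.
Import numFieldNormedType.Exports.
Set Implicit Arguments.
Unset Strict Implicit.
Unset Printing Implicit Defensive.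
Local Open Scope classical_set_scope.
Local Open Scope ring_scope.

(** Let C bound -L from above and let A bound L on the unit balls of the
    distribution.  If x and y are joined by a horizontal path that takes the
    time T at speed at most 1, then every competitor for the value at x gives
    one for the value at y: run it up to time -T, then follow the path
    ([append], [W11_append]).  The shift in time multiplies the cost of the
    first part by exp(-lambda T), and the path costs at most A T
    ([cost_append]), so that u(y) <= exp(-lambda T) u(x) + A T.  Since
    L >= -C, also u(x) >= -C / lambda; with 1 - exp(-lambda T) <= lambda T this
    gives u(y) - u(x) <= C T + A T, where lambda has cancelled
    ([value_path_le]).  Reversing the path exchanges x and y.  It remains to
    find, for a given horizontal curve, such a path with T arbitrarily close to
    the length of the curve.

    This last point is a change of parameter ([subunit_path_of_curve]).
    For a curve g with speed f and for e > 0, the function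
    s(t) = e t + (integral of f up to t) is strictly increasing, and its inverse
    sigma is Lipschitz with constant 1/e, so that g o sigma is again absolutely
    continuous; where sigma is differentiable the speed of g o sigma is
    f / (e + f) <= 1, and the total time exceeds the length by e (b - a) only.
    That almost every time is good for g o sigma rests on two facts.  First,
    s transports the measure of density e + f to Lebesgue measure, hence
    preimages of null sets by sigma are null ([unstretch_null]).  Second, s is
    almost everywhere differentiable with derivative e + f, by Lebesgue's
    differentiation theorem, for which the speed f has to be measurable
    ([hnorm_velocity_measurable]).  A velocity is recorded in a chart that
    varies with the base point in an arbitrary way; the chain rule translates it
    into one fixed chart, where it is a limit of difference quotients, and its
    components in a local frame are recovered by solving the normal equations
    with the Gram matrix of the frame.

    The integrand of the cost is treated without measurability: the integral of
    a nonnegative function is the supremum of the integrals of the simple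
    functions below it, and for such lower integrals monotonicity, homogeneity,
    invariance under translations and subadditivity against a measurable
    function hold in general.  Splitting the integrand into positive and
    negative parts, this is all that the comparison of costs uses. *)

(** * Lower integrals *)

Section lower_integral.
Local Open Scope ereal_scope.
Context (R : realType).
Notation mu := (@lebesgue_measure R).

Import HBNNSimple.

(** The integral is defined as a supremum over simple functions, whether f is
    measurable or not. *)
Lemma integral_nnsfun_le (f : R -> \bar R) (h : {nnsfun measurableTypeR R >-> R}) :
  (forall x, (h x)%:E <= f x) -> \int[mu]_x (h x)%:E <= \int[mu]_x f x.
Proof.
move=> hf; rewrite integralT_nnsfun ge0_integralTE.
  by apply: ereal_sup_ubound; exists h.
by move=> x; apply: le_trans (hf x); rewrite lee_fin.
Qed.

Lemma integral_le_of_nnsfun (f : R -> \bar R) (z : \bar R) :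
  (forall x, 0 <= f x) ->
  (forall h : {nnsfun measurableTypeR R >-> R}, (forall x, (h x)%:E <= f x) ->
     \int[mu]_x (h x)%:E <= z) ->
  \int[mu]_x f x <= z.
Proof.
move=> f0 hz; rewrite ge0_integralTE//; apply: ge_ereal_sup => _ [h /= hf <-].
by rewrite -integralT_nnsfun; exact: hz.
Qed.

Lemma integral_le_pointwise (f g : R -> \bar R) :
  (forall x, 0 <= f x <= g x) -> \int[mu]_x f x <= \int[mu]_x g x.
Proof.
move=> fg; apply: integral_le_of_nnsfun => [x|h hf]; first by case/andP: (fg x).
by apply: integral_nnsfun_le => x; apply: le_trans (hf x) _; case/andP: (fg x).
Qed.

(** A simple function below f becomes one below g, with the same integral, once
    it is set to zero on the exceptional null set. *)
Lemma integral_le_ae (f g : R -> \bar R) :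
  (forall x, 0 <= f x) -> (forall x, 0 <= g x) ->
  {ae mu, forall x, f x <= g x} -> \int[mu]_x f x <= \int[mu]_x g x.
Proof.
move=> f0 g0 [N [mN N0 fgN]]; apply: integral_le_of_nnsfun => // h hf.
have mh : measurable_fun setT (EFin \o h) by exact/measurable_EFinP.
have mNC : measurable (~` N) by exact: measurableC.
have -> : \int[mu]_x (h x)%:E = \int[mu]_x ((EFin \o h) \_ (~` N)) x.
  rewrite -integral_mkcond -setTD; apply: ge0_negligible_integral => //.
  by move=> x _; rewrite lee_fin.
apply: integral_le_pointwise => x; rewrite patchE; case: ifPn => xN.
  rewrite /= lee_fin fun_ge0/=; apply: le_trans (hf x) _.
  by move: xN; rewrite inE => xN; apply: contra_notP xN => /fgN.
by rewrite lexx g0.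
Qed.

(** If a simple function h lies below f + g, then the positive part of h - g is
    measurable and lies below f.  Measurability of one of the two summands is
    what makes a lower integral subadditive. *)
Lemma integral_leD (f : R -> \bar R) (g : R -> R) :
  (forall x, 0 <= f x) -> (forall x, (0 <= g x)%R) -> measurable_fun setT g ->
  \int[mu]_x (f x + (g x)%:E) <= \int[mu]_x f x + \int[mu]_x (g x)%:E.
Proof.
move=> f0 g0 mg; apply: integral_le_of_nnsfun => [x|h hfg].
  by rewrite adde_ge0// lee_fin.
pose r x : R := Num.max (h x - g x)%R 0%R.
have mr : measurable_fun setT r.
  apply: measurable_maxr => //; apply: measurable_funB; last exact: mg.
  exact: measurable_funP.
have r0 x : (0 <= r x)%R by rewrite /r le_max lexx orbT.
apply: (@le_trans _ _ (\int[mu]_x ((r x)%:E + (g x)%:E))).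
  apply: integral_le_pointwise => x; rewrite -EFinD !lee_fin fun_ge0 /=.
  by rewrite -lerBlDr /r le_max lexx.
rewrite ge0_integralD//; [|by move=> x _; rewrite lee_fin|exact/measurable_EFinP
  |by move=> x _; rewrite lee_fin|exact/measurable_EFinP].
apply: leeD => //; apply: integral_le_pointwise => x.
rewrite lee_fin r0/= /r; case: (leP (h x - g x)%R 0%R) => _.
  exact: f0.
by rewrite EFinB leeBlDr//; exact: hfg.
Qed.

Lemma lebesgue_measure_shift (c : R) (A : set (measurableTypeR R)) :
  measurable A ->
  pushforward mu (fun x : measurableTypeR R => (x + c)%R : measurableTypeR R) A
    = mu A.
Proof.
move=> mA; have mc : measurable_fun [set: measurableTypeR R]
    (fun x : measurableTypeR R => (x + c)%R : measurableTypeR R).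
  exact: measurable_funD.
pose mc' := isMeasurableFun.Build _ _ _ _ _ mc.
pose phi : {mfun _ >-> _} := HB.pack
  (fun x : measurableTypeR R => (x + c)%R : measurableTypeR R) mc'.
apply/esym; apply: (@lebesgue_measure_unique _ (pushforward mu phi)) => //=
  _ [[a b]] _ <-.
rewrite /pushforward/= [X in mu X = _](_ : _ = `]a, b]%classic)//.
have -> : (fun x : R => (x + c)%R) @^-1` `]a, b] = `](a - c)%R, (b - c)%R]%classic.
  by apply/seteqP; split=> x/=; rewrite !in_itv/= lerBrDr ltrBlDr.
rewrite !lebesgue_measure_itv/= !lte_fin ltrD2r.
by case: ifP => // _; rewrite -!EFinB; congr EFin; lra.
Qed.

(** Translates of the simple functions below f are the simple functions below
    the translate of f. *)
Lemma integral_shift (c : R) (f : R -> \bar R) : (forall x, 0 <= f x) ->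
  \int[mu]_x f (x + c)%R = \int[mu]_x f x.
Proof.
suff le_shift e g : (forall x, 0 <= g x) ->
    \int[mu]_x g (x + e)%R <= \int[mu]_x g x.
  move=> f0; apply/eqP; rewrite eq_le le_shift//=.
  have := le_shift (- c)%R (fun x => f (x + c)%R) (fun x => f0 _).
  by under eq_integral do rewrite subrK.
move=> g0; apply: integral_le_of_nnsfun => // h hg.
have mh : measurable_fun setT (EFin \o h).
  exact/measurable_EFinP.
have mc : measurable_fun [set: measurableTypeR R]
    (fun x : measurableTypeR R => (x - e)%R : measurableTypeR R).
  exact: measurable_funB.
have -> : \int[mu]_x (h x)%:E = \int[mu]_x (h (x - e)%R)%:E.
  rewrite -(@ge0_integral_pushforward _ _ _ _ _ _ mc mu setT (EFin \o h))//=.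
    apply: eq_measure_integral => A mA _.
    exact: esym (lebesgue_measure_shift (- e) mA).
  by move=> y _; rewrite lee_fin.
apply: integral_le_pointwise => x; rewrite lee_fin fun_ge0/=.
by rewrite -[X in _ <= g X](subrK e).
Qed.

Lemma integral_posZl (k : R) (f : R -> \bar R) : (0 < k)%R ->
  (forall x, 0 <= f x) -> \int[mu]_x (k%:E * f x) = k%:E * \int[mu]_x f x.
Proof.
suff leZ e g : (0 < e)%R -> (forall x, 0 <= g x) ->
    \int[mu]_x (e%:E * g x) <= e%:E * \int[mu]_x g x.
  move=> k0 f0; apply/eqP; rewrite eq_le leZ//=.
  rewrite -lee_pdivlMl//.
  have k0' : (0 < k^-1)%R by rewrite invr_gt0.
  have := leZ k^-1%R (fun x => k%:E * f x) k0' _.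
  under eq_integral do rewrite muleA -EFinM mulVf ?gt_eqF// mul1e.
  by apply => x; rewrite mule_ge0// lee_fin ltW.
move=> e0 g0; apply: integral_le_of_nnsfun => [x|h hg].
  by rewrite mule_ge0// lee_fin ltW.
have ei0 : (0 < e^-1)%R by rewrite invr_gt0.
have mh : measurable_fun setT (EFin \o h).
  exact/measurable_EFinP.
rewrite -lee_pdivrMl// -ge0_integralZl_EFin ?(ltW ei0)//; last first.
  by move=> x _; rewrite lee_fin.
apply: integral_le_pointwise => x; rewrite -EFinM lee_fin mulr_ge0 ?(ltW ei0) ?fun_ge0//=.
by rewrite EFinM lee_pdivrMl//; exact: hg.
Qed.

End lower_integral.

(** * Absolutely continuous functions of a real variable *)

Section absolute_continuity.
Context (R : realType).
Implicit Types (a b c m : R) (f sigma : R -> R).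

Lemma itvoo_meet (s t s' t' : R) : s < t -> s < t' -> s' < t -> s' < t' ->
  (`]s, t[%classic `&` `]s', t'[%classic) !=set0.
Proof.
move=> st st' s't s't'; exists ((Num.max s s' + Num.min t t') / 2).
have : Num.max s s' < Num.min t t' by rewrite gt_max !lt_min st st' s't s't'.
move=> h; have [h1 h2] := midf_lt h.
split; rewrite /= in_itv/=; apply/andP; split.
- by apply: le_lt_trans h1; rewrite le_max lexx.
- by apply: lt_le_trans h2 _; rewrite ge_min lexx.
- by apply: le_lt_trans h1; rewrite le_max lexx orbT.
- by apply: lt_le_trans h2 _; rewrite ge_min lexx orbT.
Qed.

(** A nondecreasing Lipschitz map sends disjoint intervals to disjoint intervals
    and multiplies their total length by the Lipschitz constant at most. *)
Lemma abs_continuous_comp a b a' b' (k : R) f sigma : 0 < k ->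
  (forall u, a' <= u <= b' -> a <= sigma u <= b) ->
  (forall u v, a' <= u -> u <= v -> v <= b' ->
     0 <= sigma v - sigma u <= k * (v - u)) ->
  abs_continuous a b f -> abs_continuous a' b' (f \o sigma).
Proof.
move=> k0 sab slip acf e e0; have [d d0 fd] := acf e e0.
exists (d / k); first exact: divr_gt0.
move=> m s t st dis std.
have sin i : a' <= s i <= b' by have [-> + /=] := st i; exact: le_trans.
have tin i : a' <= t i <= b' by have [+ + ->] := st i; rewrite andbT; exact: le_trans.
have slipi i : 0 <= sigma (t i) - sigma (s i) <= k * (t i - s i).
  by have [? ? ?] := st i; exact: slip.
apply: fd => [i||].
- have /andP[as_ _] := sab _ (sin i); have /andP[_ tb] := sab _ (tin i).
  by split=> //; rewrite -subr_ge0; have /andP[] := slipi i.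
- move=> i j _ _ [u []]; rewrite /= !in_itv/= => /andP[su ut] /andP[su' ut'].
  apply: dis => //.
  have lts p q : sigma (s p) < sigma (t q) -> s p < t q.
    move=> pq; rewrite ltNge; apply: contraTN pq => tqsp; rewrite -leNgt.
    have /andP[as_ _] := tin q; have /andP[_ tb] := sin p.
    by rewrite -subr_ge0; have /andP[] := slip _ _ as_ tqsp tb.
  by apply: itvoo_meet; apply: lts; apply: lt_trans; eassumption.
- apply: le_lt_trans (_ : k * \sum_(i < m) (t i - s i) < d).
    rewrite mulr_sumr; apply: ler_sum => i _.
    by have /andP[] := slipi i.
  by rewrite mulrC -ltr_pdivlMr.
Qed.

Lemma abs_continuous_opp a b f :
  abs_continuous a b f -> abs_continuous (- b) (- a) (f \o -%R).
Proof.
move=> acf e e0; have [d d0 fd] := acf e e0; exists d => // m s t st dis std.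
under eq_bigr do rewrite /= distrC.
apply: (fd m (fun i => - t i) (fun i => - s i)) => [i||].
- by have [h1 h2 h3] := st i; split; lra.
- move=> i j _ _ [u []]; rewrite /= !in_itv/= => ui uj.
  by apply: dis => //; exists (- u); split; rewrite /= in_itv/=; lra.
- by under eq_bigr do rewrite opprK addrC.
Qed.

Let clip_min a m (s t : R) : a <= m -> a <= s -> s <= t ->
  [/\ a <= Num.min s m, Num.min s m <= Num.min t m, Num.min t m <= m
    & Num.min t m - Num.min s m <= t - s].
Proof.
by rewrite /Num.min; case: (ltP s m) => ?; case: (ltP t m) => ? ? ? ?; split; lra.
Qed.

Let clip_max m b (s t : R) : m <= b -> s <= t -> t <= b ->
  [/\ m <= Num.max s m, Num.max s m <= Num.max t m, Num.max t m <= b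
    & Num.max t m - Num.max s m <= t - s].
Proof.
by rewrite /Num.max; case: (ltP s m) => ?; case: (ltP t m) => ? ? ? ?; split; lra.
Qed.

(** Each interval is cut at the junction m: a family of disjoint intervals in
    [a, b] yields one in [a, m] and one in [m, b]. *)
Lemma abs_continuous_cat a m b f : a <= m -> m <= b ->
  abs_continuous a m f -> abs_continuous m b f -> abs_continuous a b f.
Proof.
move=> am mb acl acr e e0; have e20 : 0 < e / 2 by exact: divr_gt0.
have [d1 d10 fd1] := acl _ e20; have [d2 d20 fd2] := acr _ e20.
exists (Num.min d1 d2); first by rewrite lt_min d10.
move=> k s t st dis; rewrite lt_min => /andP[std1 std2].
have h1 : \sum_(i < k) `|f (Num.min (t i) m) - f (Num.min (s i) m)| < e / 2.
  apply: fd1 => [i||].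
  - by have [h1 h2 h3] := st i; have [] := clip_min am h1 h2.
  - move=> i j _ _ [u []]; rewrite /= !in_itv/= !gt_min !lt_min.
    move=> /andP[ui /andP[uti um]] /andP[uj /andP[utj _]].
    have su x : (x < u) || (m < u) -> x < u.
      by case/orP => // mu; move: (lt_trans mu um); rewrite ltxx.
    by apply: dis => //; exists u; split; rewrite /= in_itv/= su.
  - apply: le_lt_trans std1; apply: ler_sum => i _; have [h1 h2 _] := st i.
    by have [] := clip_min am h1 h2.
have h2 : \sum_(i < k) `|f (Num.max (t i) m) - f (Num.max (s i) m)| < e / 2.
  apply: fd2 => [i||].
  - by have [h2 h3 h4] := st i; have [] := clip_max mb h3 h4.
  - move=> i j _ _ [u []]; rewrite /= !in_itv/= !gt_max !lt_max.
    move=> /andP[/andP[usi mu] ui] /andP[/andP[usj _] uj].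
    have ut x : (u < x) || (u < m) -> u < x.
      by case/orP => // um; move: (lt_trans mu um); rewrite ltxx.
    by apply: dis => //; exists u; split; rewrite /= in_itv/= ?usi ?usj ut.
  - apply: le_lt_trans std2; apply: ler_sum => i _; have [_ h3 h4] := st i.
    by have [] := clip_max mb h3 h4.
rewrite [e]splitr; apply: le_lt_trans (ltrD h1 h2).
rewrite -big_split/=; apply: ler_sum => i _; have [_ h3 _] := st i.
rewrite /Num.min /Num.max; case: (ltP (t i) m) => tm; case: (ltP (s i) m) => sm.
- by rewrite subrr normr0 addr0.
- by move: (lt_le_trans tm (le_trans sm h3)); rewrite ltxx.
- by rewrite addrC; exact: ler_distD.
- by rewrite subrr normr0 add0r.
Qed.

End absolute_continuity.

(** * Functions with continuous partial derivatives *)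

Section continuous_partials.
Context (R : realType).

(** The mean value theorem between 0 and r, with r of any sign. *)
Lemma MVT_origin (g dg : R -> R) (r : R) :
  (forall s : R, `|s| <= `|r| -> is_derive s 1 g (dg s)) ->
  exists2 c, `|c| <= `|r| & g r - g 0 = dg c * r.
Proof.
move=> dgE; have cg (a b : R) : (forall s, a <= s <= b -> `|s| <= `|r|) ->
    {within `[a, b], continuous g}.
  move=> ab; apply: derivable_within_continuous => s; rewrite in_itv/= => /ab sr.
  exact: (@ex_derive _ _ _ _ _ _ _ (dgE _ sr)).
have [r0|r0] := leP 0 r.
  have inr s : 0 <= s <= r -> `|s| <= `|r|.
    by case/andP => s0 sr; rewrite !ger0_norm.
  have [|c c0r ->] := @MVT_segment R g dg 0 r r0 _ (cg _ _ inr).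
    move=> s; rewrite in_itv/= => /andP[s0 sr]; apply: dgE.
    by apply: inr; rewrite !ltW.
  by exists c; [apply: inr; rewrite in_itv/= in c0r|rewrite subr0].
have inr s : r <= s <= 0 -> `|s| <= `|r|.
  by case/andP => rs s0; rewrite !ler0_norm ?(ltW r0)// lerN2.
have [|c c0r E] := @MVT_segment R g dg r 0 (ltW r0) _ (cg _ _ inr).
  move=> s; rewrite in_itv/= => /andP[s0 sr]; apply: dgE.
  by apply: inr; rewrite !ltW.
exists c; first by apply: inr; rewrite in_itv/= in c0r.
by rewrite -opprB E sub0r mulrN opprK.
Qed.

(** The increment of f from p to p + h is the sum of the increments along the
    coordinate axes, where the mean value theorem compares each of them with the
    partial derivative at p. *)
Lemma differentiable_partials (m : nat) (U : set 'rV[R]_m) (f : 'rV[R]_m -> R)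
    (p : 'rV[R]_m) : open U -> U p ->
  (forall q i, U q -> derivable f q (delta_mx 0 i)) ->
  (forall i, {for p, continuous (fun q => 'D_(delta_mx 0 i) f q)}) ->
  differentiable f p.
Proof.
move=> oU Up derf contf.
pose D i : R := 'D_(delta_mx 0 i) f p.
pose col : 'cV[R]_m := \col_i D i.
pose df (h : 'rV[R]_m) : R := (h *m col) 0 0.
have dfE h : df h = \sum_i h 0 i * D i.
  by rewrite /df mxE; apply: eq_bigr => i _; rewrite mxE.
have lin_df : linear df.
  by move=> a u v; rewrite /df mulmxDl -scalemxAl !mxE.
pose dfM := GRing.isLinear.Build _ _ _ _ _ lin_df.
pose dfL : {linear _ -> _} := HB.pack df dfM.
have cdf : continuous df.
  move=> q; have -> : df = \sum_i (fun h : 'rV[R]_m => h 0 i * D i).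
    by apply/funext => h; rewrite dfE fct_sumE.
  apply: differentiable_continuous; apply: differentiable_sum => i.
  by apply: differentiableM => //; exact: differentiable_coord.
have exp : f \o shift p = cst (f p) + df +o_ (0 : 'rV[R]_m) id.
  apply/eqaddoP => e e0.
  pose e' := e / (m.+1)%:R.
  have e'0 : 0 < e' by rewrite divr_gt0.
  have : \forall q \near p, U q /\ forall i, `|D i - 'D_(delta_mx 0 i) f q| <= e'.
    apply: filterI; first exact: open_nbhs_nbhs.
    have near_i i : \forall q \near p, `|D i - 'D_(delta_mx 0 i) f q| <= e'.
      by have /cvgrPdist_le/(_ _ e'0) := contf i.
    exact: (filter_forall _ near_i).
  move=> /(@nbhs_ballP _ 'rV[R]_m)[d /= d0 dP].
  apply/(@nbhs_ballP _ 'rV[R]_m); exists d => // h.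
  rewrite -ball_normE /= sub0r normrN => hd.
  have hi i : `|h 0 i| <= `|h|.
    by rewrite [leRHS]/Num.Def.normr/= mx_normrE; exact: (le_bigmax _ _ (0, i)).
  pose hk k : 'rV[R]_m := \row_i (if (i < k)%N then h 0 i else 0).
  have hkS (k : 'I_m) : hk k.+1 = h 0 k *: delta_mx 0 k + hk k.
    apply/rowP => i; rewrite !mxE eqxx ltnS leq_eqVlt -val_eqE /=.
    by case: (ltngtP i k) => [||/val_inj ->] /=; rewrite ?mulr0 ?mulr1 ?add0r ?addr0.
  have near_p (k : 'I_m) (c : R) : `|c| <= `|h 0 k| ->
      ball p d (c *: delta_mx 0 k + (hk k + p)).
    move=> ck; rewrite -ball_normE /= distrC addrA addrK.
    apply: le_lt_trans hd; rewrite [leLHS]/Num.Def.normr/= mx_normrE.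
    apply: bigmax_le => // -[j i] _ /=; rewrite !mxE ord1 eqxx /=.
    have [->|ik] := eqVneq i k.
      by rewrite ltnn mulr1 addr0 (le_trans ck).
    by rewrite mulr0 add0r; case: ifP; rewrite ?normr0.
  have step (k : 'I_m) :
      `|f (hk k.+1 + p) - f (hk k + p) - h 0 k * D k| <= e' * `|h|.
    pose g (s : R) := f (s *: delta_mx 0 k + (hk k + p)).
    pose dg (s : R) := 'D_(delta_mx 0 k) f (s *: delta_mx 0 k + (hk k + p)).
    have [s sk|c ck] := @MVT_origin g dg (h 0 k) _.
      have /(derf _ k) Df := (dP _ (near_p _ _ sk)).1.
      have gE : (fun t : R => t^-1 *: ((g \o shift s) (t *: 1) - g s)) =
          (fun t : R => t^-1 *: ((f \o shift (s *: delta_mx 0 k + (hk k + p)))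
             (t *: delta_mx 0 k) - f (s *: delta_mx 0 k + (hk k + p)))).
        apply/funext => t; rewrite /g /=; congr (_ *: (f _ - _)).
        by rewrite [_%:A]mulr1 (scalerDl (delta_mx 0 k)) -addrA.
      by apply: DeriveDef; rewrite /derivable /derive gE.
    rewrite /g hkS scale0r add0r -(addrA (h 0 k *: _)) => ->.
    rewrite mulrC -mulrBr normrM mulrC ler_pM// distrC.
    exact: (dP _ (near_p _ _ ck)).2.
  rewrite -[leLHS]/(`|f (h + p) - (f p + df h)|).
  have -> : f (h + p) = f (hk m + p).
    by congr (f (_ + _)); apply/rowP => i; rewrite mxE ltn_ord.
  have -> : f p = f (hk 0%N + p).
    by congr f; rewrite -[LHS]add0r; congr (_ + _); apply/rowP => i; rewrite !mxE.
  rewrite opprD addrA -(@telescope_sumr _ 0 m (fun k => f (hk k + p)))//.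
  rewrite big_mkord dfE -sumrB; apply: le_trans (ler_norm_sum _ _ _) _.
  apply: le_trans (ler_sum _ (fun k _ => step k)) _.
  rewrite sumr_const card_ord -[leLHS]mulr_natl mulrA ler_wpM2r//.
  rewrite /e' mulrCA ger_pMr// ler_pdivrMr// mul1r ler_nat//.
have dE : 'd f p = df :> (_ -> _) by exact: (@diff_unique _ _ _ _ dfL).
apply/diff_locallyP; rewrite dE; split=> //.
Qed.

End continuous_partials.

(** * Tangent vectors in charts *)

Section derivatives.
Context (R : realType) (V : normedModType R).
Implicit Types f g : V -> V.

Lemma derive_left_inverse_eq0 f g (p v : V) :
  differentiable f p -> differentiable g (f p) ->
  (\forall q \near p, g (f q) = q) -> 'D_v f p = 0 -> v = 0.
Proof.
move=> df dg gf; rewrite (deriveE _ df) => f0.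
have dgf : differentiable (g \o f) p by exact: differentiable_comp.
rewrite -[LHS](derive_id p) -(near_eq_derive (f := g \o f))//.
by rewrite (deriveE _ dgf) (diff_comp df dg) /= f0 linear0.
Qed.

Lemma derive_comp_curve f (p : R -> V) (t : R) :
  differentiable f (p t) -> derivable p t 1 ->
  derivable (f \o p) t 1 /\ 'D_1 (f \o p) t = 'D_(derive1 p t) f (p t).
Proof.
move=> df /derivable1_diffP dp.
have dfp : differentiable (f \o p) t by exact: differentiable_comp.
split; first exact/derivable1_diffP.
by rewrite (deriveE _ dfp) (diff_comp dp df) /= -(derive1E' dp) -deriveE.
Qed.

End derivatives.

Section charts.
Context (R : realType) (n : nat) (M : smoothManifold R n).
Implicit Types c : chart R n M.

Lemma cinvK c (x : M) : cdom c x -> cinv c (cmap c x) = x.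
Proof. by move=> cx; apply: cmapK; exact: mem_set. Qed.

Lemma chart_image_open c (V : set M) : open V ->
  open (cmap c @` (cdom c `&` V)).
Proof.
move=> oV; rewrite openE => _ [x [cx Vx] <-].
have := @cinv_continuous _ _ _ c; rewrite continuous_open_subspace; last first.
  exact: cimg_open.
have Wx : (cmap c @` cdom c) (cmap c x) by exists x.
move=> /(_ (cmap c x)); rewrite inE => /(_ Wx) cc.
have Vnear : \forall q \near cmap c x, V (cinv c q).
  apply: cc; rewrite cinvK//; exact: open_nbhs_nbhs.
have Wnear : \forall q \near cmap c x, (cmap c @` cdom c) q.
  by apply: open_nbhs_nbhs; split=> //; exact: cimg_open.
rewrite /interior; near=> q.
have [y cy yq] : (cmap c @` cdom c) q by near: q.
exists y => //; split=> //.
have : V (cinv c q) by near: q.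
by rewrite -yq cinvK.
Unshelve. all: by end_near. Qed.

Lemma cmap_continuous_at c (x : M) : cdom c x -> {for x, continuous (cmap c)}.
Proof.
move=> cx; have := @cmap_continuous _ _ _ c.
rewrite continuous_open_subspace; last exact: cdom_open.
by apply; rewrite inE.
Qed.

Lemma smooth_continuous_at (W : set 'rV[R]_n) (f : 'rV[R]_n -> R) q :
  open W -> smooth_on W f -> W q -> {for q, continuous f}.
Proof.
move=> oW /(_ 0%N)[+ _] Wq.
by rewrite continuous_open_subspace//; apply; rewrite inE.
Qed.

Lemma smooth_differentiable (W : set 'rV[R]_n) (f : 'rV[R]_n -> R) q :
  open W -> smooth_on W f -> W q -> differentiable f q.
Proof.
move=> oW /(_ 1%N)[_ fW] Wq; apply: (differentiable_partials oW Wq).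
  by move=> p i Wp; exact: (fW i).1.
move=> i; have [_ [+ _]] := fW i.
by rewrite continuous_open_subspace//; apply; rewrite inE.
Qed.

Definition transition c c' : 'rV[R]_n -> 'rV[R]_n := cmap c' \o cinv c.

Lemma transition_differentiable c c' (x : M) : atlas c -> atlas c' ->
  cdom c x -> cdom c' x -> differentiable (transition c c') (cmap c x).
Proof.
move=> ac ac' cx c'x.
have -> : transition c c' = \sum_(i < n) (fun q =>
    (fun q => cmap c' (cinv c q) 0 i) q *: (delta_mx 0 i : 'rV[R]_n)).
  apply/funext => q; rewrite fct_sumE /transition /=.
  exact: row_sum_delta.
apply: differentiable_sum => i; apply: differentiableZl.
apply: (smooth_differentiable _ (atlas_smooth ac ac' i)).
  by apply: chart_image_open; exact: cdom_open.
by exists x.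
Qed.

(** In particular [tcoord c] is linear on each tangent space, being the
    differential of a transition map. *)
Lemma tcoordE c (x : M) (v : tangent x) : atlas c -> cdom c x ->
  tcoord c v = v *m jacobian (transition (chart_at x) c) (cmap (chart_at x) x).
Proof.
move=> ac cx; rewrite /tcoord deriveEjacobian//.
apply: transition_differentiable => //; first exact: chart_atP.
exact: chart_at_dom.
Qed.

(** The differential of a transition map is injective, since the opposite
    transition map is a left inverse of the map near the point. *)
Lemma tcoord_eq0 c (x : M) (v : tangent x) : atlas c -> cdom c x ->
  tcoord c v = 0 -> v = 0 :> 'rV[R]_n.
Proof.
move=> ac cx v0; pose c0 := chart_at x.
have ac0 : atlas c0 by exact: chart_atP.
have c0x : cdom c0 x by exact: chart_at_dom.
have d1 := transition_differentiable ac0 ac c0x cx.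
have d2 := transition_differentiable ac ac0 cx c0x.
have tx : transition c0 c (cmap c0 x) = cmap c x.
  by rewrite /transition/= cinvK.
rewrite -tx in d2.
apply: (derive_left_inverse_eq0 d1 d2 _ v0).
have oW : open (cmap c0 @` (cdom c0 `&` cdom c)).
  by apply: chart_image_open; exact: cdom_open.
near=> q; have [y [c0y cy] <-] : (cmap c0 @` (cdom c0 `&` cdom c)) q.
  by near: q; apply: open_nbhs_nbhs; split=> //; exists x.
by rewrite /transition /= (cinvK c0y) (cinvK cy).
Unshelve. all: by end_near. Qed.

(** The velocity at t is recorded in the chart chosen at g t; this chain rule
    expresses it in a chart c that can be kept fixed while t varies. *)
Lemma velocity_in_chart c (g : R -> M) (t : R) : atlas c -> cdom c (g t) ->
  {for t, continuous g} -> has_velocity g t ->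
  derivable (cmap c \o g) t 1 /\
  'D_1 (cmap c \o g) t = tcoord c (velocity g t).
Proof.
move=> ac cgt gt vt; pose c0 := chart_at (g t).
have ac0 : atlas c0 by exact: chart_atP.
have c0x : cdom c0 (g t) by exact: chart_at_dom.
have d1 := transition_differentiable ac0 ac c0x cgt.
have E : {near t, transition c0 c \o (cmap c0 \o g) =1 cmap c \o g}.
  near=> s; rewrite /transition /= cinvK//.
  near: s; apply: gt; apply: open_nbhs_nbhs; split=> //; exact: cdom_open.
have [d2 D2] := derive_comp_curve d1 vt.
split; first exact: near_eq_derivable E d2.
by rewrite -(near_eq_derive _ E) D2.
Unshelve. all: by end_near. Qed.

End charts.

(** * Measurability of matrices and derivatives *)

Section measurable_matrices.
Context d (T : measurableType d) (R : realType) (D : set T).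

Definition mx_measurable (m n : nat) (A : T -> 'M[R]_(m, n)) : Prop :=
  forall i j, measurable_fun D (fun t => A t i j).

Lemma mx_measurableM m n p (A : T -> 'M[R]_(m, n)) (B : T -> 'M[R]_(n, p)) :
  mx_measurable A -> mx_measurable B -> mx_measurable (fun t => A t *m B t).
Proof.
move=> mA mB i j.
rewrite (_ : (fun t => _) = (fun t => \sum_k A t i k * B t k j)).
  by apply: measurable_sum => k; exact: measurable_funM.
by apply/funext => t; rewrite mxE.
Qed.

Lemma mx_measurable_tr m n (A : T -> 'M[R]_(m, n)) :
  mx_measurable A -> mx_measurable (fun t => (A t)^T).
Proof. by move=> mA i j; under eq_fun do rewrite mxE; exact: mA. Qed.

Lemma measurable_det n (A : T -> 'M[R]_n) :
  mx_measurable A -> measurable_fun D (fun t => \det (A t)).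
Proof.
move=> mA; rewrite /determinant; apply: measurable_sum => s.
by apply: measurable_funM => //; apply: measurable_prod => i _.
Qed.

Lemma mx_measurable_adj n (A : T -> 'M[R]_n) :
  mx_measurable A -> mx_measurable (fun t => \adj (A t)).
Proof.
move=> mA i j; under eq_fun do rewrite mxE /cofactor.
apply: measurable_funM => //; apply: measurable_det => k l.
by under eq_fun do rewrite !mxE; exact: mA.
Qed.

Lemma measurable_funV (f : T -> R) : measurable D ->
  (forall t, D t -> f t != 0) -> measurable_fun D f ->
  measurable_fun D (fun t => (f t)^-1).
Proof.
move=> mD f0 mf.
have oF : open [set x : R | x != 0] by exact: open_neq.
apply: (@measurable_comp _ _ _ _ _ _ [set x : R | x != 0] GRing.inv) => //.
- exact: open_measurable.
- by move=> _ [t Dt <-] /=; exact: f0.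
- apply: open_continuous_measurable_fun => // x; rewrite inE /= => x0.
  exact: inv_continuous.
Qed.

End measurable_matrices.

Section gram_matrix.
Context (R : realFieldType) (k n : nat).

(** A vector in the kernel of A *m A^T gives a vector u *m A of norm zero. *)
Lemma gram_unitmx (A : 'M[R]_(k, n)) : row_free A -> A *m A^T \in unitmx.
Proof.
move=> fA; rewrite -row_free_unit; apply: inj_row_free => u uAA.
have : (u *m A) *m (u *m A)^T = 0 by rewrite trmx_mul !mulmxA -(mulmxA u) uAA mul0mx.
move=> /matrixP/(_ 0 0); rewrite !mxE => /eqP.
rewrite psumr_eq0 => [/allP uA0|i _]; last by rewrite [X in _ * X]mxE -expr2 sqr_ge0.
apply/eqP; rewrite -(mulmx_free_eq0 u fA); apply/eqP/rowP => i.
have := uA0 i (mem_index_enum _); rewrite [X in _ * X]mxE -expr2 sqrf_eq0.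
by move=> /eqP ->; rewrite mxE.
Qed.

(** The left inverse of a |-> a *m A given by the normal equations. *)
Definition gram_coef (A : 'M[R]_(k, n)) (w : 'rV[R]_n) : 'rV[R]_k :=
  w *m A^T *m ((\det (A *m A^T))^-1 *: \adj (A *m A^T)).

Lemma gram_coefK (A : 'M[R]_(k, n)) (a : 'rV[R]_k) :
  row_free A -> gram_coef A (a *m A) = a.
Proof.
move=> /gram_unitmx uA; rewrite /gram_coef -(mulmxA a).
by have := mulmxK uA a; rewrite /invmx uA.
Qed.

End gram_matrix.

Section measurable_derivative.
Context (R : realType).

(** A derivative is the limit of the difference quotients of steps 1/(m+1).
    They are measurable on the whole line once f is replaced by zero outside of
    I. *)
Lemma measurable_fun_derive (I E : set R) (f : R -> R) : open I ->
  measurable E -> E `<=` I -> {in I, continuous f} ->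
  (forall t, E t -> derivable f t 1) -> measurable_fun E (fun t => 'D_1 f t).
Proof.
move=> oI mE EI cf df; have mI : measurable I by exact: open_measurable.
pose F : R -> R := f \_ I.
have mF : measurable_fun setT F.
  apply/(measurable_restrictT _ mI); exact: open_continuous_measurable_fun.
pose q (m : nat) t := (harmonic m)^-1 * (F (harmonic m + t) - F t).
apply: (@measurable_fun_cvg _ _ _ _ q) => [m|t Et].
  apply: measurable_funTS; apply: measurable_funM => //; apply: measurable_funB => //.
  by apply: (measurableT_comp mF); exact: measurable_funD.
have Ff : {near t, f =1 F}.
  near=> s; rewrite /F patchE ifT//; apply: mem_set; near: s.
  by apply: open_nbhs_nbhs; split=> //; exact: EI.
have dF := near_eq_derivable Ff (df t Et).
rewrite (near_eq_derive _ Ff).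
have hq : q ^~ t = (fun h => h^-1 *: ((F \o shift t) (h *: 1) - F t)) \o harmonic.
  by apply/funext => m; rewrite /q /= [_%:A]mulr1.
rewrite hq.
have h0 : @harmonic R @ \oo --> (0 : R)^'.
  move=> A A0; have : \forall m \near \oo, harmonic m != 0 :> R -> A (harmonic m).
    exact: (cvg_harmonic A0).
  apply: filterS => m; apply.
  by rewrite invr_eq0 pnatr_eq0.
exact: (cvg_comp _ _ h0 dF).
Unshelve. all: by end_near. Qed.

End measurable_derivative.

(** * The speed of a horizontal curve is measurable *)

Section horizontal_speed.
Context (R : realType) (n : nat) (M : smoothManifold R n) (S : subRiemannian M).
Implicit Types (x : M) (g : R -> M).

Lemma distr_linear x (a : R) (u v : tangent x) :
  distr S u -> distr S v -> distr S (a *: u + v : tangent x).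
Proof.
have [U [X [Ux [_ _ _ DX]]]] := distr_smooth S x.
by rewrite DX//= => Du Dv; rewrite addmx_sub// scalemx_sub.
Qed.

Lemma distr0 x : distr S (0 : tangent x).
Proof.
by have [U [X [Ux [_ _ _ ->]]]] := distr_smooth S x; rewrite //= sub0mx.
Qed.

Lemma distrZ x (a : R) (v : tangent x) : distr S v -> distr S (a *: v : tangent x).
Proof.
move=> Dv; rewrite -[X in distr S X]addr0; apply: distr_linear => //.
exact: distr0.
Qed.

Lemma inner0l x (w : tangent x) : distr S w -> inner S (0 : tangent x) w = 0.
Proof.
move=> Dw; have D0 := distr0 x.
have /eqP := @inner_linear _ _ _ S x 1 0 0 w D0 D0 Dw.
by rewrite scaler0 addr0 mul1r -subr_eq0 opprD addrA subrr sub0r oppr_eq0 => /eqP.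
Qed.

Lemma innerZ x (a : R) (v w : tangent x) : distr S v -> distr S w ->
  inner S (a *: v : tangent x) w = a * inner S v w.
Proof.
move=> Dv Dw; rewrite -[X in inner S X _]addr0.
by rewrite inner_linear//; [rewrite inner0l// addr0|exact: distr0].
Qed.

Lemma hnormZ x (a : R) (v : tangent x) : distr S v ->
  hnorm S (a *: v : tangent x) = `|a| * hnorm S v.
Proof.
move=> Dv; have Dav := distrZ a Dv.
rewrite /hnorm innerZ// inner_sym// innerZ// mulrA -expr2.
by rewrite sqrtrM ?sqr_ge0// sqrtr_sqr.
Qed.

Lemma distr_sum x k (a : 'I_k -> R) (u : 'I_k -> tangent x) :
  (forall i, distr S (u i)) -> distr S (\sum_i a i *: u i : tangent x).
Proof.
move=> Du; apply: big_ind => [|v w Dv Dw|i _]; first exact: distr0.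
  by rewrite -[v]scale1r; exact: distr_linear.
exact: distrZ.
Qed.

Lemma inner_suml x k (a : 'I_k -> R) (u : 'I_k -> tangent x) (w : tangent x) :
  (forall i, distr S (u i)) -> distr S w ->
  inner S (\sum_i a i *: u i : tangent x) w = \sum_i a i * inner S (u i) w.
Proof.
move=> Du Dw.
suff [] : distr S (\sum_i a i *: u i : tangent x) /\
  inner S (\sum_i a i *: u i : tangent x) w = \sum_i a i * inner S (u i) w by [].
apply: (big_rec2 (fun (v : tangent x) r => distr S v /\ inner S v w = r)).
  by split; [exact: distr0|exact: inner0l].
move=> i r v _ [Dv <-]; split; first exact: distr_linear.
by rewrite inner_linear.
Qed.

Lemma inner_sum x k (a : 'I_k -> R) (u : 'I_k -> tangent x) :
  (forall i, distr S (u i)) ->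
  inner S (\sum_i a i *: u i : tangent x) (\sum_i a i *: u i : tangent x) =
  \sum_i a i * \sum_j a j * inner S (u j) (u i).
Proof.
move=> Du; have Ds := distr_sum a Du; rewrite inner_suml//.
apply: eq_bigr => i _; congr (_ * _).
by rewrite inner_sym// inner_suml.
Qed.

Lemma frame_distr x k U (X : 'I_k -> vfield M) : local_frame (distr S) U X ->
  U x -> forall i, distr S (X i x).
Proof.
move=> [_ _ _ DX] Ux i; rewrite DX//=.
have -> : X i x = row i (frame_mx X x) :> 'rV[R]_n.
  by apply/rowP => j; rewrite !mxE.
exact: row_sub.
Qed.

(** In the chart c the frame has components Xi and the velocity has components
    w = a *m Xi, so that a is a measurable function of Xi and w; the squared
    norm is the quadratic form of a in the Gram matrix of the inner product. *)
Lemma hnorm_velocity_measurable_in_frame c U (X : 'I_(rank S) -> vfield M)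
    (I E : set R) g :
  atlas c -> local_frame (distr S) U X -> open I -> measurable E -> E `<=` I ->
  (forall t, I t -> cdom c (g t) /\ U (g t)) ->
  (forall t, I t -> {for t, continuous g}) ->
  (forall t, E t -> has_velocity g t /\ distr S (velocity g t)) ->
  measurable_fun E (fun t => hnorm S (velocity g t)).
Proof.
move=> ac frX oI mE EI gcU cg velE.
have [oU sX freeX DX] := frX.
have cmg t : I t -> {for t, continuous (cmap c \o g)}.
  move=> It; apply: continuous_comp; first exact: cg.
  by apply: cmap_continuous_at; exact: (gcU _ It).1.
pose W := cmap c @` (cdom c `&` U).
have oW : open W by exact: chart_image_open.
have Wg t : I t -> W (cmap c (g t)) by move=> It; exists (g t); [exact: gcU|].
have mW (F : 'rV[R]_n -> R) : (forall q, W q -> {for q, continuous F}) ->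
    measurable_fun E (fun t => F (cmap c (g t))).
  move=> cF; apply: (@measurable_funS _ _ _ _ I) => //; first exact: open_measurable.
  apply: open_continuous_measurable_fun => // t; rewrite inE => It.
  by apply: continuous_comp; [exact: cmg|apply: cF; exact: Wg].
pose w t : 'rV[R]_n := \row_j 'D_1 (fun s => cmap c (g s) 0 j) t.
have wE t : E t -> w t = tcoord c (velocity g t).
  move=> Et; have It := EI _ Et; have [vt _] := velE _ Et.
  have [dc <-] := velocity_in_chart ac (gcU _ It).1 (cg _ It) vt.
  by rewrite derive_mx//; apply/rowP => j; rewrite !mxE.
have mw : mx_measurable E w.
  move=> i j; rewrite ord1; under eq_fun do rewrite mxE.
  apply: (measurable_fun_derive oI mE EI) => [t|t Et].
    rewrite inE => It.
    apply: (@continuous_comp _ _ _ (cmap c \o g) (fun q => q 0 j)); first exact: cmg.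
    by apply: differentiable_continuous; exact: differentiable_coord.
  have It := EI _ Et; have [vt _] := velE _ Et.
  have [dc _] := velocity_in_chart ac (gcU _ It).1 (cg _ It) vt.
  exact: (derivable_mxP _ _ _).1 dc 0 j.
pose Xi t : 'M[R]_(rank S, n) :=
  \matrix_(i, j) vf_coord c (X i) (cmap c (g t)) 0 j.
have mXi : mx_measurable E Xi.
  move=> i j; under eq_fun do rewrite mxE.
  apply: (mW (fun q => vf_coord c (X i) q 0 j)) => q Wq.
  by apply: smooth_continuous_at Wq; [|exact: (sX i c ac j)].
have XiE t : E t -> Xi t = frame_mx X (g t) *m
    jacobian (transition (chart_at (g t)) c) (cmap (chart_at (g t)) (g t)).
  move=> Et; have [ct Ut] := gcU _ (EI _ Et).
  apply/row_matrixP => i; rewrite row_mul.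
  have -> : row i (frame_mx X (g t)) = X i (g t) by apply/rowP => j; rewrite !mxE.
  rewrite -tcoordE//; apply/rowP => j; rewrite !mxE /vf_coord.
  by rewrite cinvK.
have fXi t : E t -> row_free (Xi t).
  move=> Et; have [ct Ut] := gcU _ (EI _ Et); apply: inj_row_free => u.
  rewrite XiE// mulmxA -[X in X *m _]/(u *m _ : tangent (g t)) -tcoordE//.
  move=> /(tcoord_eq0 ac ct)/eqP; rewrite mulmx_free_eq0; last exact: freeX.
  by move/eqP.
pose G t : 'M[R]_(rank S) := \matrix_(i, j) inner S (X j (g t)) (X i (g t)).
have mG : mx_measurable E G.
  move=> i j; under eq_fun do rewrite mxE.
  pose F q := inner S (X j (cinv c q)) (X i (cinv c q)).
  apply: (eq_measurable_fun (fun t => F (cmap c (g t)))).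
    move=> t; rewrite inE => Et; have [ct Ut] := gcU _ (EI _ Et).
    by rewrite /F cinvK.
  apply: (mW F) => q Wq.
  apply: smooth_continuous_at Wq => //.
  apply: (inner_smooth oU (sX j) (sX i) _ _ ac) => x Ux.
    exact: (frame_distr frX).
  exact: (frame_distr frX).
pose a t : 'rV[R]_(rank S) := gram_coef (Xi t) (w t).
have ma : mx_measurable E a.
  have mA : mx_measurable E (fun t => Xi t *m (Xi t)^T).
    by apply: mx_measurableM => //; exact: mx_measurable_tr.
  have XiU t : E t -> Xi t *m (Xi t)^T \in unitmx.
    by move=> Et; apply: gram_unitmx; exact: fXi.
  apply: mx_measurableM; first by apply: mx_measurableM => //; exact: mx_measurable_tr.
  move=> i j; under eq_fun do rewrite mxE.
  apply: measurable_funM; last exact: mx_measurable_adj.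
  apply: measurable_funV => //; last exact: measurable_det.
  by move=> t Et; rewrite -unitfE -unitmxE; exact: XiU.
have aE t : E t -> velocity g t = \sum_i a t 0 i *: X i (g t) :> 'rV[R]_n.
  move=> Et; have [ct Ut] := gcU _ (EI _ Et); have [_] := velE _ Et.
  rewrite DX//= => /submxP[b vb].
  have -> : a t = b.
    by rewrite /a wE// tcoordE// vb -mulmxA -XiE// gram_coefK//; exact: fXi.
  rewrite vb mulmx_sum_row; apply: eq_bigr => i _; congr (_ *: _).
  by apply/rowP => j; rewrite !mxE.
apply: (eq_measurable_fun (fun t =>
    Num.sqrt (\sum_i a t 0 i * \sum_j a t 0 j * G t i j))).
  move=> t; rewrite inE => Et; have [ct Ut] := gcU _ (EI _ Et).
  rewrite /hnorm [velocity g t]aE// inner_sum; last exact: (frame_distr frX).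
  congr Num.sqrt; apply: eq_bigr => i _; congr (_ * _).
  by apply: eq_bigr => j _; rewrite [G t i j]mxE.
have msqrt : measurable_fun [set: R] (@Num.sqrt R).
  by apply: continuous_measurable_fun; exact: sqrt_continuous.
apply: (measurableT_comp msqrt).
apply: measurable_sum => i; apply: measurable_funM => //.
by apply: measurable_sum => j; exact: measurable_funM.
Qed.

(** Countably many intervals with rational endpoints, each mapped into the domain
    of a chart and of a frame, cover the set of times. *)
Lemma hnorm_velocity_measurable (a b : R) (E : set R) (g : R -> M) :
  measurable E -> E `<=` `]a, b[ ->
  (forall t, a < t < b -> {for t, continuous g}) ->
  (forall t, E t -> has_velocity g t /\ distr S (velocity g t)) ->
  measurable_fun E (fun t => hnorm S (velocity g t)).
Proof.
move=> mE Eab cg velE; set f := (X in measurable_fun _ X).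
pose J (pq : rat * rat) : set R := E `&` `](ratr pq.1), (ratr pq.2)[%classic.
pose piece pq : set R := if `[< measurable_fun (J pq) f >] then J pq else set0.
pose F k := if unpickle k is Some pq then piece pq else set0.
have mJ (p q : R) : measurable (E `&` `]p, q[%classic) by exact: measurableI.
have mpiece pq : measurable (piece pq) /\ measurable_fun (piece pq) f.
  rewrite /piece; case: ifPn => [/asboolP mf|_]; first by split; [exact: mJ|].
  by split=> //; exact: measurable_fun_set0.
have -> : E = \bigcup_k F k.
  apply/seteqP; split=> [t Et|t [k _]]; last first.
    rewrite /F; case: unpickle => // pq; rewrite /piece.
    by case: ifP => // _ [].
  have abt : a < t < b by have := Eab _ Et; rewrite /= in_itv.
  have [U [X [Ut frX]]] := distr_smooth S (g t).
  pose c := chart_at (g t).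
  have oV : open (U `&` cdom c) by apply: openI; [case: frX|exact: cdom_open].
  have Vt : \forall s \near t, (U `&` cdom c) (g s).
    apply: (cg t abt); apply: open_nbhs_nbhs; split=> //.
    by split=> //; exact: chart_at_dom.
  have abn : \forall s \near t, `]a, b[%classic s.
    by apply: open_nbhs_nbhs; split; [exact: interval_open|rewrite /= in_itv].
  have : \forall s \near t, (U `&` cdom c) (g s) /\ `]a, b[%classic s.
    exact: filterI.
  move=> /nbhs_ballP[e /= e0 eP].
  have te : t - e < t by rewrite ltrBlDr ltrDl.
  have et : t < t + e by rewrite ltrDl.
  have [p] := rat_in_itvoo te; rewrite in_itv/=.
  move=> /andP[ep pt].
  have [q] := rat_in_itvoo et; rewrite in_itv/=.
  move=> /andP[tq qe].
  have pqP s : `](ratr p : R), ratr q[%classic s ->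
      (U `&` cdom c) (g s) /\ `]a, b[%classic s.
    rewrite /= in_itv/= => /andP[ps sq]; apply: eP.
    by rewrite -ball_normE /ball_ /= ltr_distlC (lt_trans ep)// (lt_trans sq).
  have mpq : measurable_fun (J (p, q)) f.
    apply: (@hnorm_velocity_measurable_in_frame c U X
      `](ratr p : R), ratr q[%classic) => //.
    - exact: chart_atP.
    - exact: mJ.
    - by move=> s [].
    - by move=> s /pqP[[]].
    - by move=> s /pqP[_]; rewrite /= in_itv/=; exact: cg.
    - by move=> s [/velE].
  have FE : F (pickle (p, q)) = J (p, q) by rewrite /F pickleK /piece asboolT.
  exists (pickle (p, q)); first exact: I.
  by rewrite FE; split; [|rewrite /= in_itv /= pt].
have mF k : measurable (F k) /\ measurable_fun (F k) f.
  rewrite /F; case: unpickle => [pq|]; first exact: mpiece.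
  by split; [exact: measurable0|exact: measurable_fun_set0].
by apply/measurable_fun_bigcup => k; have [] := mF k.
Qed.

End horizontal_speed.

(** * Arc length and its inverse *)

Section almost_everywhere.
Context (R : realType).
Notation mu := (@lebesgue_measure R).

Lemma ae_impl (P Q : R -> Prop) : (forall t, P t -> Q t) ->
  {ae mu, forall t : R, P t} -> {ae mu, forall t : R, Q t}.
Proof.
move=> PQ; apply: filterS => //; exact: (ae_filter_ringOfSetsType mu).
Qed.

Lemma ae_and (P Q : R -> Prop) : {ae mu, forall t : R, P t} ->
  {ae mu, forall t : R, Q t} -> {ae mu, forall t : R, P t /\ Q t}.
Proof.
by move=> aP aQ; apply: filterI => //; exact: (ae_filter_ringOfSetsType mu).
Qed.

End almost_everywhere.

Section density.
Local Open Scope ereal_scope.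
Context d (T : measurableType d) (R : realType).
Variables (mu : {measure set T -> \bar R}) (g : T -> R).
Hypotheses (mg : measurable_fun setT g) (g0 : forall t, (0 <= g t)%R).

(** The hypotheses are arguments of the definition so that the measure
    structure attached to it can use them. *)
Definition density of measurable_fun setT g & (forall t, (0 <= g t)%R) :=
  fun A : set T => \int[mu]_(t in A) (g t)%:E.

Let nu := density mg g0.

Let density0 : nu set0 = 0.
Proof. exact: integral_set0. Qed.

Let density_ge0 A : 0 <= nu A.
Proof. by apply: integral_ge0 => t _; rewrite lee_fin. Qed.

Let density_semi_sigma_additive : semi_sigma_additive nu.
Proof.
move=> F mF tF mUF; rewrite [X in _ --> X](_ : _ = \sum_(k <oo) nu (F k)).
  by apply: is_cvg_nneseries => k _ _; exact: density_ge0.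
apply: ge0_integral_bigcup => //.
  by apply: measurable_funTS; exact/measurable_EFinP.
by move=> t _; rewrite lee_fin.
Qed.

HB.instance Definition _ := isMeasure.Build _ _ _ nu
  density0 density_ge0 density_semi_sigma_additive.

End density.

Section arc_length.
Context (R : realType).
Notation mu := (@lebesgue_measure R).
Variables (f : R -> R) (e : R).
Hypotheses (mf : measurable_fun setT f) (f0 : forall t, 0 <= f t).
Hypotheses (intf : mu.-integrable setT (EFin \o f)) (e0 : 0 < e).

Let F (t : R) : R := \int[mu]_(r in `]-oo, t]) f r.

(** The arc length function of a curve of speed f, with the slope e added to
    make it strictly increasing. *)
Definition stretch (t : R) : R := e * t + F t.
Local Notation s := stretch.

Let intf_itv (i : interval R) : mu.-integrable [set` i] (EFin \o f).
Proof. exact: integrableS intf. Qed.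

Let F_sub (u v : R) : u <= v -> F v - F u = \int[mu]_(r in `]u, v]) f r.
Proof. by move=> uv; apply: Rintegral_itvB. Qed.

Let F_ge0 t : 0 <= F t.
Proof. exact: Rintegral_ge0. Qed.

Let F_le t : F t <= \int[mu]_r f r.
Proof.
rewrite -subr_ge0 -set_itvNyy Rintegral_itvB//.
exact: Rintegral_ge0.
Qed.

Lemma stretch_sub (u v : R) : u <= v ->
  s v - s u = e * (v - u) + \int[mu]_(r in `]u, v]) f r.
Proof. by move=> uv; rewrite -F_sub// /s mulrBr; ring. Qed.

Lemma stretch_expand (u v : R) : u <= v -> e * (v - u) <= s v - s u.
Proof. by move=> uv; rewrite stretch_sub// lerDl; exact: Rintegral_ge0. Qed.

Lemma stretch_lt (u v : R) : u < v -> s u < s v.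
Proof.
move=> uv; rewrite -subr_gt0; apply: lt_le_trans (stretch_expand (ltW uv)).
by rewrite mulr_gt0// subr_gt0.
Qed.

Lemma stretch_ltE (u v : R) : (s u < s v) = (u < v).
Proof.
apply/idP/idP; last exact: stretch_lt.
by apply: contraTT; rewrite -!leNgt le_eqVlt => /orP[/eqP->//|/stretch_lt/ltW].
Qed.

Lemma stretch_continuous : continuous s.
Proof.
move=> t; apply: cvgD; first by apply: cvgMr; exact: cvg_id.
have t1 : t - 1 <= t + 1 by lra.
have := @parameterized_integral_continuous R (t - 1) (t + 1) f t1 (intf_itv _).
have sub : `]t - 1, t + 1[%classic `<=` `[t - 1, t + 1]%classic.
  exact: subset_itv_oo_cc.
move=> /(continuous_subspaceW sub).
rewrite continuous_open_subspace; last exact: interval_open.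
move=> /(_ t); rewrite inE /= in_itv/= => ct.
have {}ct : {for t, continuous (parameterized_integral mu (t - 1) ^~ f)}.
  by apply: ct; apply/andP; split; lra.
have FE : {near t, (fun r => F (t - 1) + parameterized_integral mu (t - 1) r f) =1 F}.
  near=> r; have tr : t - 1 <= r.
    by near: r; apply: lt_le_nbhsr; lra.
  rewrite /parameterized_integral -Rintegral_itv_obnd_cbnd//.
  by rewrite -F_sub// addrC subrK.
apply: cvg_trans (near_eq_cvg FE) _.
rewrite -[F t](nbhs_singleton FE); apply: cvgD ct; exact: cvg_cst.
Unshelve. all: by end_near. Qed.

Lemma stretch_surj (y : R) : exists t, s t = y.
Proof.
pose C := \int[mu]_r f r.
have C0 : 0 <= C by exact: Rintegral_ge0.
have le1 : s ((y - C) / e) <= y.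
  have := F_le ((y - C) / e).
  by rewrite /s mulrCA divff ?gt_eqF// mulr1 -/C; lra.
have le2 : y <= s (y / e).
  by rewrite /s mulrCA divff ?gt_eqF// mulr1 lerDl.
have le3 : (y - C) / e <= y / e by rewrite ler_pM2r ?invr_gt0// gerDl oppr_le0.
have [||t _ <-] := @IVT R s _ _ y le3; last by exists t.
- by apply: continuous_subspaceT; exact: stretch_continuous.
- rewrite ge_min le1 le_max le2 orbT//.
Qed.

Definition unstretch (y : R) : R := sval (cid (stretch_surj y)).
Local Notation sigma := unstretch.

Lemma unstretchK : cancel sigma s.
Proof. by move=> y; rewrite /sigma; case: cid. Qed.

Lemma stretchK : cancel s sigma.
Proof.
move=> t; have := unstretchK (s t).
by case: (ltgtP (sigma (s t)) t) => // /stretch_lt + h; rewrite h ltxx.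
Qed.

Lemma unstretch_bounds (u v : R) : u <= v ->
  0 <= sigma v - sigma u <= e^-1 * (v - u).
Proof.
move=> uv; have suv : sigma u <= sigma v.
  by rewrite leNgt -stretch_ltE !unstretchK -leNgt.
rewrite subr_ge0 suv/= ler_pdivlMl//; have := stretch_expand suv.
by rewrite !unstretchK.
Qed.

Lemma unstretch_continuous : continuous sigma.
Proof.
move=> y; apply/cvgrPdist_le => r r0; near=> z.
have zy : `|y - z| <= e * r by near: z; apply: cvgr_dist_le => //; rewrite mulr_gt0.
have [yz|/ltW yz] := leP y z.
  have /andP[h1 h2] := unstretch_bounds yz.
  rewrite distrC ger0_norm//; apply: le_trans h2 _; rewrite ler_pdivrMl//.
  by rewrite distrC ger0_norm ?subr_ge0// in zy.
have /andP[h1 h2] := unstretch_bounds yz.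
rewrite ger0_norm//; apply: le_trans h2 _; rewrite ler_pdivrMl//.
by rewrite ger0_norm ?subr_ge0// in zy.
Unshelve. all: by end_near. Qed.

(** Lebesgue's differentiation theorem. *)
Lemma stretch_derive : {ae mu, forall t : R, is_derive t 1 s (e + f t)}.
Proof.
have := @FTC1Ny R f (fun y => intf_itv _) (open_integrable_locally openT intf).
apply: ae_impl => t [dF DF].
rewrite derive1E in DF; have dF' : is_derive t 1 F (f t) := DeriveDef dF DF.
have dE : is_derive t 1 (e *: id : R -> R) (e *: (1 : R)) by exact: is_deriveZ.
rewrite [_%:A]mulr1 in dE.
exact: is_deriveD.
Qed.

Lemma unstretch_derive : {ae mu, forall t : R, is_derive (s t) 1 sigma (e + f t)^-1}.
Proof.
apply: ae_impl stretch_derive => t ds; apply: is_derive_inverse ds _.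
- by near=> x; exact: stretchK.
- by near=> x; exact: stretch_continuous.
- by rewrite gt_eqF// ltr_wpDr.
Unshelve. all: by end_near. Qed.

(** The image by the stretching of the measure of density e + f is Lebesgue
    measure, because both give the length b - a to ]a, b].  So the preimage of N
    by the inverse has the measure that the density gives to N. *)
Lemma unstretch_null (N : set (measurableTypeR R)) : measurable N -> mu N = 0%E ->
  mu (sigma @^-1` N) = 0%E.
Proof.
move=> mN N0.
have mg : measurable_fun setT (fun t => e + f t) by exact: measurable_funD.
have g0 t : 0 <= e + f t by rewrite addr_ge0// ltW.
pose nu : {measure set (measurableTypeR R) -> \bar R} := density mu mg g0.
pose s' : measurableTypeR R -> measurableTypeR R := s.
have ms : measurable_fun [set: measurableTypeR R] s'.
  by apply: continuous_measurable_fun; exact: stretch_continuous.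
have msigma : measurable (sigma @^-1` N).
  rewrite -[X in measurable X]setTI.
  by apply: continuous_measurable_fun => //; exact: unstretch_continuous.
pose ms' := isMeasurableFun.Build _ _ _ _ _ ms.
pose phi : {mfun _ >-> _} := HB.pack s' ms'.
have -> : mu (sigma @^-1` N) = pushforward nu phi (sigma @^-1` N).
  apply: (@lebesgue_measure_unique _ (pushforward nu phi)) => // _ [[a b]] _ <- /=.
  rewrite /pushforward/= [in RHS](_ : _ @^-1` _ = `]sigma a, sigma b]%classic).
    rewrite lebesgue_measure_itv/= lte_fin; case: ifPn => [ab|]; last first.
      rewrite -leNgt => ba; rewrite set_itv_ge ?measure0// bnd_simp -leNgt.
      by rewrite -subr_ge0; have /andP[] := unstretch_bounds ba.
    have sab : sigma a <= sigma b.
      by rewrite -subr_ge0; have /andP[] := unstretch_bounds (ltW ab).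
    have mab : mu `]sigma a, sigma b]%classic = (sigma b - sigma a)%:E.
      rewrite lebesgue_measure_itv/= lte_fin; case: ifPn => // ba.
      by rewrite (_ : sigma b = sigma a) ?subrr//; apply/le_anti; rewrite sab leNgt ba.
    have intab : (\int[mu]_(r in `]sigma a, sigma b]) (f r)%:E =
        (\int[mu]_(r in `]sigma a, sigma b]) f r)%:E)%E.
      by rewrite /Rintegral fineK// integrable_fin_num//; exact: intf_itv.
    rewrite /density; under eq_integral do rewrite EFinD.
    rewrite ge0_integralD//; last 3 first.
    - by move=> t _; rewrite lee_fin ltW.
    - by move=> t _; rewrite lee_fin.
    - by apply: measurable_funTS; exact/measurable_EFinP.
    have := stretch_sub sab; rewrite !unstretchK => ba.
    rewrite integral_cst// [X in (_ * X)%E]mab intab -EFinM -!EFinD.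
    by congr EFin; exact: ba.
  have lts u t : (u < s t) = (sigma u < t) by rewrite -{1}(unstretchK u) stretch_ltE.
  have les u t : (s t <= u) = (t <= sigma u).
    by rewrite !leNgt -{1}(unstretchK u) stretch_ltE.
  by apply/seteqP; split=> t /=; rewrite !in_itv/= /s' lts les.
rewrite /pushforward/= (_ : _ @^-1` _ = N); last first.
  by apply/seteqP; split=> t /=; rewrite stretchK.
rewrite /nu /density; apply: null_set_integral => //.
by apply/measurable_EFinP/measurable_funTS.
Qed.

End arc_length.

(** * Changes of parameter of horizontal curves *)

Section change_of_parameter.
Context (R : realType) (n : nat) (M : smoothManifold R n) (S : subRiemannian M).
Notation mu := (@lebesgue_measure R).
Implicit Types (g : R -> M) (sigma : R -> R).

Lemma within_itv_comp (a b a' b' : R) g sigma : continuous sigma ->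
  (forall u, a' <= u <= b' -> a <= sigma u <= b) ->
  {within `[a, b], continuous g} -> {within `[a', b'], continuous (g \o sigma)}.
Proof.
move=> cs sab /subspace_continuousP cg; apply/subspace_continuousP => t tab.
have stab : `[a, b]%classic (sigma t).
  by move: tab; rewrite /= !in_itv/=; exact: sab.
apply: cvg_comp (cg _ stab) => P; rewrite /within /= => wP.
have sP : \forall u \near t, `[a, b]%classic (sigma u) -> P (sigma u).
  exact: (cs t _ wP).
suff : \forall u \near t, `[a', b']%classic u -> P (sigma u) by [].
near=> u; rewrite /= in_itv/= => /sab su; have : `[a, b]%classic (sigma u) -> P (sigma u).
  by near: u.
by apply; rewrite /= in_itv.
Unshelve. all: by end_near. Qed.

Lemma within_itv_continuous_at (a b : R) g t :
  {within `[a, b], continuous g} -> a < t < b -> {for t, continuous g}.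
Proof.
move=> /(continuous_subspaceW (@subset_itv_oo_cc _ _ a b)).
rewrite continuous_open_subspace; last exact: interval_open.
by move=> cg tab; apply: cg; rewrite inE /= in_itv.
Qed.

Lemma ac_curve_comp (a b a' b' : R) g sigma : continuous sigma ->
  (forall u, a' <= u <= b' -> a <= sigma u <= b) ->
  (forall f, abs_continuous a b f -> abs_continuous a' b' (f \o sigma)) ->
  ac_curve a b g -> ac_curve a' b' (g \o sigma).
Proof.
move=> cs sab acs [cg acg]; split; first exact: within_itv_comp sab cg.
by move=> phi sphi cphi; apply: (acs (phi \o g)); exact: acg.
Qed.

Lemma velocity_comp g sigma (t l : R) : is_derive t 1 sigma l ->
  has_velocity g (sigma t) ->
  has_velocity (g \o sigma) t /\
  velocity (g \o sigma) t = l *: velocity g (sigma t) :> 'rV[R]_n.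
Proof.
move=> ds vg; rewrite /has_velocity /velocity /=.
set p := fun s => cmap (chart_at (g (sigma t))) (g s).
have dp : differentiable p (sigma t) by exact/derivable1_diffP.
have dsig : differentiable sigma t by apply/derivable1_diffP; exact: ex_derive.
have dps : differentiable (p \o sigma) t by exact: differentiable_comp.
split; first exact/derivable1_diffP.
rewrite (derive1E' dps) (diff_comp dsig dp) /= (deriv1E vg) -deriveE//.
by rewrite derive_val.
Qed.

Lemma ae_comp sigma (P : R -> Prop) : continuous sigma ->
  (forall N : set (measurableTypeR R), measurable N -> mu N = 0%E ->
     mu (sigma @^-1` N) = 0%E) ->
  {ae mu, forall t : R, P t} -> {ae mu, forall t : R, P (sigma t)}.
Proof.
move=> cs ns [N [mN N0 PN]]; exists (sigma @^-1` N); split.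
- rewrite -[X in measurable X]setTI.
  by apply: continuous_measurable_fun.
- exact: ns.
- by move=> t /= Pt; exact: PN.
Qed.

Lemma ae_shift (c : R) (P : R -> Prop) :
  {ae mu, forall t : R, P t} -> {ae mu, forall t : R, P (t + c)}.
Proof.
apply: ae_comp => [|N mN N0]; last by rewrite -N0; exact: lebesgue_measure_shift.
by move=> t; apply: cvgD; [exact: cvg_id|exact: cvg_cst].
Qed.

Lemma ae_opp (P : R -> Prop) :
  {ae mu, forall t : R, P t} -> {ae mu, forall t : R, P (- t)}.
Proof.
apply: ae_comp => [|N mN N0]; last by rewrite -N0; exact: lebesgue_measureN.
by move=> t; exact: opp_continuous.
Qed.

(** Parametrizing on [-T, 0] lets a path be appended to a curve that is defined
    on the negative half-line. *)
Definition subunit_path (T : R) (x y : M) (p : R -> M) : Prop :=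
  [/\ ac_curve (- T) 0 p, p (- T) = x, p 0 = y &
    {ae mu, forall t : R, - T <= t <= 0 -> [/\ has_velocity p t,
       distr S (velocity p t) & hnorm S (velocity p t) <= 1]}].

Lemma subunit_path_rev T x y p : subunit_path T x y p ->
  subunit_path T y x (p \o (fun t => - (t + T))).
Proof.
move=> [acp px py aep]; split => /=; last 1 first.
- have := ae_shift T (ae_opp aep); apply: ae_impl => t tP tT.
  have [|vp Dp np] := tP; first by lra.
  have ds : is_derive t 1 (fun t : R => - (t + T)) (- 1).
    by apply: is_deriveN; apply: is_derive_shift.
  have [vq ->] := velocity_comp ds vp.
  split=> //; first exact: distrZ.
  by rewrite hnormZ// normrN normr1 mul1r.
- apply: ac_curve_comp acp.
  + move=> t; apply: cvgN; apply: cvgD; [exact: cvg_id|exact: cvg_cst].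
  + by move=> u; lra.
  + move=> f acf; have := abs_continuous_opp acf; rewrite oppr0 opprK => acN.
    apply: (abs_continuous_comp (k := 1) _ _ _ acN) => //.
      by move=> u; lra.
    by move=> u v; lra.
- by rewrite addNr oppr0.
- by rewrite add0r.
Qed.

Lemma ae_neq (c : R) : {ae mu, forall t : R, t != c}.
Proof.
exists [set c]; split; [exact: measurable_set1|exact: lebesgue_measure_set1|].
by move=> t /= /negP; rewrite negbK => /eqP.
Qed.

(** Thanks to the slope e > 0 the inverse of the stretching is Lipschitz even
    where the curve stands still; the price is the extra time e * (b - a). *)
Lemma subunit_path_of_curve (a b e : R) (g : R -> M) :
  a <= b -> 0 < e -> W11 S a b g -> (curve_length S a b g < +oo)%E ->
  exists T p, [/\ 0 <= T, subunit_path T (g a) (g b) p &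
    (T%:E <= curve_length S a b g + (e * (b - a))%:E)%E].
Proof.
move=> ab e0 [acg [N [mN N0 hN]]] lfin.
have cg t : a < t < b -> {for t, continuous g}.
  by apply: within_itv_continuous_at; case: acg.
pose E : set R := `]a, b[%classic `\` N.
have mE : measurable E by exact: measurableD.
have velE t : E t -> has_velocity g t /\ distr S (velocity g t).
  move=> [tab Nt]; apply: contrapT => bad; apply: Nt; apply: hN => /= ok.
  by apply: bad; apply: ok; exact: subset_itv_oo_cc tab.
pose f : R -> R := (fun t => hnorm S (velocity g t)) \_ E.
have f0 t : 0 <= f t by rewrite /f patchE; case: ifP => // _; exact: sqrtr_ge0.
have mf : measurable_fun setT f.
  apply/(measurable_restrictT _ mE).
  by apply: (@hnorm_velocity_measurable _ _ _ _ a b) => // t [].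
have lenf : (\int[mu]_t (f t)%:E <= curve_length S a b g)%E.
  rewrite /curve_length [leRHS]integral_mkcond; apply: integral_le_pointwise => t.
  rewrite lee_fin f0/= /f !patchE.
  case: ifPn => [|_]; last by case: ifP => _; rewrite lee_fin ?sqrtr_ge0.
  rewrite inE => -[tab _]; rewrite ifT//; apply: mem_set.
  exact: subset_itv_oo_cc tab.
have intf : mu.-integrable setT (EFin \o f).
  apply/integrableP; split; first exact/measurable_EFinP.
  apply: le_lt_trans lfin; apply: le_trans lenf.
  apply: integral_le_pointwise => t /=.
  by rewrite !lee_fin normr_ge0 ger0_norm/=.
pose s := stretch f e; pose sigma := unstretch f0 intf e0.
have sK : cancel s sigma by exact: stretchK.
have sigmaK : cancel sigma s by exact: unstretchK.
have sigma_b := unstretch_bounds f0 intf e0.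
have csigma : continuous sigma by exact: unstretch_continuous.
have sabE := stretch_sub e intf ab.
set T := s b - s a.
have T0 : 0 <= T.
  rewrite /T sabE addr_ge0//; first by rewrite mulr_ge0 ?subr_ge0// ltW.
  exact: Rintegral_ge0.
have sigma_le u v : u <= v -> sigma u <= sigma v.
  by move=> uv; rewrite -subr_ge0; have /andP[] := sigma_b _ _ uv.
have tin t : - T <= t <= 0 -> a <= sigma (t + s b) <= b.
  rewrite /T => /andP[h1 h2]; apply/andP; split.
    by rewrite -[leLHS]sK; apply: sigma_le; lra.
  by rewrite -[leRHS]sK; apply: sigma_le; lra.
have cshift : continuous (fun t : R => sigma (t + s b)).
  move=> t; apply: (@continuous_comp _ _ _ (fun t : R => t + s b) sigma).
    by apply: cvgD; [exact: cvg_id|exact: cvg_cst].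
  exact: csigma.
exists T, (g \o (fun t => sigma (t + s b))); split => //.
- split.
  + apply: (ac_curve_comp cshift tin) acg => h ach.
    apply: (abs_continuous_comp (k := e^-1) _ tin _ ach); first by rewrite invr_gt0.
    move=> u v _ uv _; have := sigma_b (u + s b) (v + s b).
    by rewrite lerD2r => /(_ uv); rewrite opprD addrACA subrr addr0.
  + by rewrite /= /T opprB subrK sK.
  + by rewrite /= add0r sK.
  + pose P t := [/\ a <= t <= b -> E t & is_derive (s t) 1 sigma (e + f t)^-1].
    have aeP : {ae mu, forall t : R, P t}.
      have aeN : {ae mu, forall t : R, ~ N t}.
        by exists N; split=> // t /= /contrapT.
      have := ae_and (unstretch_derive f0 intf e0)
        (ae_and aeN (ae_and (ae_neq a) (ae_neq b))).
      apply: ae_impl => t [ds [Nt [ta tb]]]; split=> // /andP[at_ bt].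
      by split=> //=; rewrite in_itv/= !lt_neqAle at_ bt tb eq_sym ta.
    have := ae_shift (s b) (ae_comp csigma (unstretch_null mf f0 intf e0) aeP).
    apply: ae_impl => t [tE ds] tT.
    have Et := tE (tin t tT); have [vg Dg] := velE _ Et.
    have {}ds : is_derive t 1 (fun t => sigma (t + s b)) (e + f (sigma (t + s b)))^-1.
      rewrite sigmaK in ds.
      have dc : is_derive t 1 (fun t : R => t + s b) 1 by exact: is_derive_shift.
      have := @is_derive1_comp R sigma (fun t : R => t + s b) t _ _ ds dc.
      by rewrite mulr1.
    have [vp ->] := velocity_comp ds vg.
    split=> //; first exact: distrZ.
    have v0 : 0 <= hnorm S (velocity g (sigma (t + s b))) by exact: sqrtr_ge0.
    rewrite hnormZ// /f patchE mem_set// ger0_norm ?invr_ge0; last first.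
      by rewrite addr_ge0// ltW.
    by rewrite ler_pdivrMl ?mulr1; [rewrite lerDr ltW|rewrite ltr_wpDr].
- rewrite /T sabE EFinD addeC leeD// ?EFinM//.
  apply: le_trans lenf.
  rewrite /Rintegral fineK; last first.
    by apply: integrable_fin_num => //; exact: (integrableS _ _ _ intf).
  apply: ge0_subset_integral => //; first exact/measurable_EFinP.
  by move=> t _; rewrite lee_fin.
Qed.

End change_of_parameter.

(** * Appending a path to a curve on the negative half-line *)

Section discount.
Context (R : realType).
Notation mu := (@lebesgue_measure R).

Lemma integral_discount (lambda : R) : 0 < lambda ->
  (\int[mu]_(t in `]-oo, 0%R]) (expR (lambda * t))%:E = (lambda^-1)%:E)%E.
Proof.
move=> l0; pose f (t : R) : \bar R := (expR (- lambda * t))%:E.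
have mf : measurable_fun [set: R] f.
  apply/measurable_EFinP; apply: measurableT_comp => //.
have f0 t : (0 <= f t)%E by rewrite lee_fin expR_ge0.
transitivity (\int[mu]_(t in `]-oo, 0%R]) f (- t)%R)%E.
  by apply: eq_integral => t _; rewrite /f mulrNN.
rewrite -ge0_integration_by_substitution0//.
have E : (lambda%:E * \int[mu]_(t in `[0%R, +oo[) f t = 1)%E.
  rewrite -(integral_exponential_pdf l0) -ge0_integralZl//; last 2 first.
  - exact: measurable_funTS.
  - by rewrite lee_fin ltW.
  rewrite [LHS]integral_mkcond; apply: eq_integral => t _.
  by rewrite /exponential_pdf !patchE; case: ifP.
have l1 : lambda != 0 by rewrite gt_eqF.
by rewrite -[LHS]mul1e -(mulVf l1) EFinM -muleA E mule1.
Qed.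

End discount.

Section concatenation.
Context (R : realType) (n : nat) (M : smoothManifold R n) (S : subRiemannian M).
Notation mu := (@lebesgue_measure R).
Implicit Types (g h k p : R -> M).

Lemma ac_curve_eq (a b : R) g h : (forall t, a <= t <= b -> g t = h t) ->
  ac_curve a b g -> ac_curve a b h.
Proof.
move=> gh [cg acg]; split.
  apply: subspace_eq_continuous cg => t; rewrite inE /= in_itv/=.
  exact: gh.
move=> phi sphi cphi e e0; have [d d0 fd] := acg phi sphi cphi e e0.
exists d => // m s t st dis std; have := fd m s t st dis std.
congr (_ < _); apply: eq_bigr => i _ /=; have [h1 h2 h3] := st i.
by rewrite !gh//; apply/andP; split => //; [exact: le_trans h3|exact: le_trans h2].
Qed.

Lemma ac_curve_cat (a m b : R) g : a <= m -> m <= b ->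
  ac_curve a m g -> ac_curve m b g -> ac_curve a b g.
Proof.
move=> am mb [cl acl] [cr acr]; split.
  rewrite (_ : `[a, b]%classic = `[a, m] `|` `[m, b])%classic.
    by apply: withinU_continuous => //; exact: interval_closed.
  apply/seteqP; split=> t /=; rewrite !in_itv/=.
    case/andP => at_ tb; case: (leP t m) => tm; [left|right].
      by rewrite at_.
    by rewrite tb (ltW tm).
  case=> /andP[h1 h2]; first by rewrite h1 (le_trans h2).
  by rewrite h2 (le_trans am).
move=> phi sphi cphi; apply: abs_continuous_cat am mb _ _.
  exact: acl.
exact: acr.
Qed.

Lemma ac_curve_sub (a b a' b' : R) g : a <= a' -> b' <= b ->
  ac_curve a b g -> ac_curve a' b' g.
Proof.
move=> aa bb.
have idab (u : R) : a' <= u <= b' -> a <= u <= b.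
  by move=> /andP[au ub]; rewrite (le_trans aa au) (le_trans ub bb).
apply: (@ac_curve_comp _ _ _ a b a' b' g id) => //.
  by move=> t; exact: cvg_id.
move=> f; apply: (abs_continuous_comp (k := 1)) => // u v _ uv _.
by rewrite subr_ge0 uv mul1r lexx.
Qed.

Lemma ac_curve_shift (a b c : R) g : ac_curve a b g ->
  ac_curve (a - c) (b - c) (g \o (fun t => t + c)).
Proof.
have cab (u : R) : a - c <= u <= b - c -> a <= u + c <= b.
  by rewrite lerBlDr lerBrDr.
apply: ac_curve_comp => //.
  by move=> t; apply: cvgD; [exact: cvg_id|exact: cvg_cst].
move=> f; apply: (abs_continuous_comp (k := 1)) => // u v _ uv _.
by apply/andP; split; lra.
Qed.

(** The predicate P absorbs the dependency of the type of a velocity on the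
    point where it is attached. *)
Lemma near_eq_velocity (P : forall x : M, tangent x -> Prop) g h (t : R) :
  {near t, g =1 h} -> has_velocity g t -> P (g t) (velocity g t) ->
  has_velocity h t /\ P (h t) (velocity h t).
Proof.
move=> gh vg Pg; have ght : g t = h t := nbhs_singleton gh.
have chE : {near t, (fun s => cmap (chart_at (h t)) (g s)) =1
    (fun s => cmap (chart_at (h t)) (h s))}.
  by near=> s; congr cmap; near: s.
split.
  rewrite /has_velocity; apply: near_eq_derivable chE _.
  by rewrite -ght.
by rewrite /velocity derive1E -(near_eq_derive (1 : R) chE) -derive1E -ght.
Unshelve. all: by end_near. Qed.

Lemma W11_neg_ae g : W11_neg S g ->
  {ae mu, forall t : R, t <= 0 -> has_velocity g t /\ distr S (velocity g t)}.
Proof.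
move=> Wg; pose P (m : nat) (t : R) := `[- m%:R, 0%R]%classic t ->
  has_velocity g t /\ distr S (velocity g t).
have : {ae mu, forall t, forall m, P m t}.
  apply: ae_foralln => m; have m0 : - m%:R <= 0 :> R by rewrite oppr_le0.
  by have [_] := Wg _ _ m0 (lexx _).
apply: ae_impl => t Pt t0; apply: (Pt (Num.truncn (- t)).+1).
rewrite /= in_itv/= t0 andbT lerNl ltW//.
by apply: truncnS_gt.
Qed.

Definition append (T : R) g p : R -> M :=
  fun t => if t <= - T then g (t + T) else p t.

Variables (T : R) (x y : M) (g p : R -> M).
Hypotheses (T0 : 0 <= T) (pxy : subunit_path S T x y p).
Hypotheses (Wg : W11_neg S g) (g0 : g 0 = x).
Let k := append T g p.

Lemma append_left (P : forall z : M, tangent z -> Prop) (t : R) :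
  t < - T -> has_velocity g (t + T) -> P _ (velocity g (t + T)) ->
  has_velocity k t /\ P _ (velocity k t).
Proof.
move=> tT vg Pg.
have ds : is_derive t 1 (fun t : R => t + T) 1 by exact: is_derive_shift.
have [vs vsE] := velocity_comp ds vg; rewrite scale1r in vsE.
apply: (near_eq_velocity _ vs).
  near=> s; rewrite /k /append ifT//; near: s; exact: lt_le_nbhsl.
by rewrite vsE.
Unshelve. all: by end_near. Qed.

Lemma append_right (P : forall z : M, tangent z -> Prop) (t : R) :
  - T < t -> has_velocity p t -> P _ (velocity p t) ->
  has_velocity k t /\ P _ (velocity k t).
Proof.
move=> tT vp; apply: near_eq_velocity => //.
near=> s; rewrite /k /append ifF//; apply/negbTE; rewrite -ltNge.
by near: s; exact: lt_nbhsr.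
Unshelve. all: by end_near. Qed.

Lemma append0 : k 0 = y.
Proof.
have [_ pT p0 _] := pxy; rewrite /k /append add0r oppr_ge0; case: ifP => // Tle.
have TE : T = 0 by apply/le_anti; rewrite Tle.
by rewrite TE g0 -pT TE oppr0.
Qed.

Lemma W11_append : W11_neg S k.
Proof.
have [acp pT p0 aep] := pxy; move=> a b ab b0; split.
  pose c := Num.min a (- T).
  have ac0 : ac_curve c 0 k.
    have cT : c <= - T by rewrite ge_min lexx orbT.
    apply: (ac_curve_cat cT); first by rewrite oppr_le0.
    - have cT0 : c + T <= 0 by rewrite -lerBrDr sub0r.
      have [+ _] := Wg cT0 (lexx 0).
      move=> /(ac_curve_shift T); rewrite addrK sub0r; apply: ac_curve_eq.
      by move=> t /andP[_ tT]; rewrite /k /append tT.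
    - apply: ac_curve_eq acp => t /andP[tT t0]; rewrite /k /append.
      case: ifP => // tT'; have -> : t = - T by apply/le_anti; rewrite tT tT'.
      by rewrite addNr g0 pT.
  by apply: ac_curve_sub ac0 => //; rewrite ge_min lexx.
have := ae_and (ae_neq (- T)) (ae_and aep (ae_shift T (W11_neg_ae Wg))).
apply: ae_impl => t [tT [pt gt]]; rewrite /= in_itv/= => /andP[_ tb].
have t0 := le_trans tb b0.
case: (ltgtP t (- T)) tT => // tT _.
  have [|vg Dg] := gt; first by rewrite -lerBrDr sub0r ltW.
  exact: (append_left (P := @distr _ _ _ S)).
have [|vp Dp _] := pt; first by rewrite (ltW tT).
exact: (append_right (P := @distr _ _ _ S)).
Qed.

End concatenation.

(** * Costs *)

(** The bound m keeps the subtracted terms finite; a may be infinite. *)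
Lemma lee_affine_sub (R : realType) (r c m : R) (a a' b b' : \bar R) :
  0 < r -> (0 <= a)%E -> (0 <= b <= m%:E)%E -> (b' <= m%:E)%E ->
  (a' <= r%:E * a + c%:E)%E -> (r%:E * b <= b')%E ->
  (a' - b' <= r%:E * (a - b) + c%:E)%E.
Proof.
move=> r0; case: b => [b||] a0 /andP[b0 bm]//; case: b' => [b'||] b'm ab bb' //.
case: a a0 ab => [a||]// a0 ab; last first.
  by rewrite addye// gt0_muley ?lte_fin// addye// leey.
move: ab bb'; rewrite -EFinB -!EFinM -!EFinD.
case: a' => [a'||]//; rewrite -?EFinB !lee_fin => ab bb'.
  by rewrite mulrBr; lra.
by rewrite addNye leNye.
Qed.

Section cost.
Context (R : realType) (n : nat) (M : smoothManifold R n) (S : subRiemannian M).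
Variables (L : lagrangian M) (lambda C A : R).
Hypotheses (lambda0 : 0 < lambda) (C0 : 0 <= C) (A0 : 0 <= A).
Hypothesis LC : forall (x : M) (v : tangent x), distr S v -> - C <= L v.
Hypothesis LA : forall (x : M) (v : tangent x), distr S v -> hnorm S v <= 1 ->
  L v <= A.
Notation mu := (@lebesgue_measure R).
Implicit Types g : R -> M.

Definition cost g : \bar R :=
  (\int[mu]_(t in `]-oo, 0%R])
     (expR (lambda * t) * L (velocity g t))%:E)%E.

Let rate g (t : R) : R := expR (lambda * t) * L (velocity g t).
Let gain g (t : R) : \bar R :=
  if t <= 0 then (Num.max (rate g t) 0)%:E else 0%E.
Let loss g (t : R) : \bar R :=
  if t <= 0 then (Num.max (- rate g t) 0)%:E else 0%E.

Let gain_ge0 g t : (0 <= gain g t)%E.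
Proof. by rewrite /gain; case: ifP => // _; rewrite lee_fin le_max lexx orbT. Qed.

Let loss_ge0 g t : (0 <= loss g t)%E.
Proof. by rewrite /loss; case: ifP => // _; rewrite lee_fin le_max lexx orbT. Qed.

Let costE g : cost g = (\int[mu]_t gain g t - \int[mu]_t loss g t)%E.
Proof.
rewrite /cost integralE; congr (_ - _)%E; rewrite integral_mkcond;
  apply: eq_integral => t _; rewrite patchE mem_setE in_itv/=.
  by rewrite /gain; case: ifP => // _; rewrite funeposE /= EFin_max.
by rewrite /loss; case: ifP => // _; rewrite funenegE /= EFin_max.
Qed.

Let loss_le g : W11_neg S g -> (\int[mu]_t loss g t <= (C / lambda)%:E)%E.
Proof.
move=> Wg.
pose B : R -> \bar R := (fun t => (C * expR (lambda * t))%:E) \_ `]-oo, 0%R]%classic.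
have B0 t : (0 <= B t)%E.
  by rewrite /B patchE; case: ifP => // _; rewrite lee_fin mulr_ge0// expR_ge0.
apply: (@le_trans _ _ (\int[mu]_t B t)%E).
  apply: integral_le_ae => //; apply: ae_impl (W11_neg_ae Wg) => t Dt.
  rewrite /loss /B patchE mem_setE in_itv/=; case: ifP => // t0.
  have [_ Dg] := Dt t0; rewrite lee_fin ge_max mulr_ge0 ?expR_ge0// andbT.
  by rewrite /rate -mulrN mulrC ler_wpM2r ?expR_ge0// lerNl LC.
rewrite -integral_mkcond; under eq_integral do rewrite EFinM.
rewrite ge0_integralZl//.
- by rewrite integral_discount.
- by apply/measurable_EFinP; apply: measurable_funTS; apply: measurableT_comp.
Qed.

Lemma cost_ge g : W11_neg S g -> ((- (C / lambda))%:E <= cost g)%E.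
Proof.
move=> Wg; rewrite costE EFinN.
apply: (@le_trans _ _ (0 - \int[mu]_t loss g t)%E).
  by rewrite sub0e leeN2; exact: loss_le.
by rewrite leeD2r//; apply: integral_ge0 => t _; exact: gain_ge0.
Qed.

(** Positive and negative parts are compared separately.  Before -T both are
    exp(-lambda T) times those of g, shifted by T.  After -T the positive part is
    at most A, and the negative part is only bounded below by 0. *)
Lemma cost_append (T : R) (x y : M) g p : 0 <= T -> subunit_path S T x y p ->
  W11_neg S g -> g 0 = x ->
  (cost (append T g p) <= (expR (- lambda * T))%:E * cost g + (A * T)%:E)%E.
Proof.
move=> T0 pxy Wg g0; set k := append T g p; pose r := expR (- lambda * T).
have r0 : 0 < r by exact: expR_gt0.
have Wk : W11_neg S k by exact: (W11_append T0 pxy Wg g0).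
have rate_left t : t < - T -> t + T <= 0 -> has_velocity g (t + T) ->
    rate k t = r * rate g (t + T).
  move=> tT _ vg.
  pose P (z : M) (v : tangent z) := L v = L (velocity g (t + T)).
  have [_ Lk] := append_left (P := P) p tT vg erefl.
  rewrite /rate Lk /r mulrA -expRD; congr (expR _ * _); ring.
have rate_right t : - T < t -> t <= 0 -> has_velocity p t -> distr S (velocity p t) ->
    hnorm S (velocity p t) <= 1 -> rate k t <= A.
  move=> tT t0 vp Dp np.
  pose P (z : M) (v : tangent z) := L v = L (velocity p t).
  have [_ Lk] := append_right (P := P) g tT vp erefl.
  rewrite /rate Lk; apply: le_trans (_ : expR (lambda * t) * A <= _).
    by rewrite ler_wpM2l ?expR_ge0// LA.
  by rewrite ler_piMl// expR_le1 mulr_ge0_le0// ltW.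
pose B : R -> R := (cst A) \_ `]- T, 0%R]%classic.
have B0 t : 0 <= B t by rewrite /B patchE; case: ifP.
have mB : measurable_fun setT B.
  by apply/(measurable_restrictT _ _).1 => //; exact: measurable_cst.
have [_ _ _ aep] := pxy.
have aeall := ae_and (ae_neq (- T)) (ae_and aep (ae_shift T (W11_neg_ae Wg))).
have gain_k : (\int[mu]_t gain k t <= r%:E * \int[mu]_t gain g t + (A * T)%:E)%E.
  apply: (@le_trans _ _ (\int[mu]_t (r%:E * gain g (t + T)%R + (B t)%:E))%E).
    apply: integral_le_ae => // [t|].
      by rewrite adde_ge0 ?lee_fin// mule_ge0// lee_fin ltW.
    apply: ae_impl aeall => t [tT [pt gt]].
    have rg0 : (0 <= r%:E * gain g (t + T)%R)%E by rewrite mule_ge0// lee_fin ltW.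
    case: (ltgtP t (- T)) tT => // tT _; last first.
      apply: (@le_trans _ _ (B t)%:E); last by rewrite leeDr.
      rewrite /gain /B patchE mem_setE in_itv/= tT /=; case: ifP => // t0.
      have [|vp Dp np] := pt; first by rewrite (ltW tT).
      by rewrite lee_fin ge_max A0 andbT rate_right.
    have t0 : t <= 0 by apply: le_trans (ltW tT) _; rewrite oppr_le0.
    have tT0 : t + T <= 0 by rewrite -lerBrDr sub0r ltW.
    have [vg _] := gt tT0.
    apply: (@le_trans _ _ (r%:E * gain g (t + T)%R)%E); last first.
      by rewrite leeDl// lee_fin.
    by rewrite /gain t0 tT0 rate_left// -EFinM lee_fin maxr_pMr ?mulr0 ?(ltW r0).
  apply: le_trans (integral_leD _ _ _) _ => // [t|].
    by rewrite mule_ge0// lee_fin ltW.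
  rewrite integral_posZl// integral_shift// leeD//.
  have -> : (\int[mu]_t (B t)%:E = \int[mu]_(t in `](- T)%R, 0%R]) A%:E)%E.
    rewrite [RHS]integral_mkcond; apply: eq_integral => t _.
    by rewrite /B !patchE; case: ifP.
  have mT : mu `](- T)%R, 0%R]%classic = T%:E.
    rewrite lebesgue_measure_itv/= lte_fin oppr_lt0.
    case: ifPn => [_|]; first by rewrite -EFinD add0r opprK.
    by rewrite -leNgt => T0'; congr EFin; apply/le_anti; rewrite T0.
  by rewrite integral_cst// [X in (_ * X)%E]mT.
have loss_k : (r%:E * \int[mu]_t loss g t <= \int[mu]_t loss k t)%E.
  rewrite -(integral_shift T)// -integral_posZl//.
  apply: integral_le_ae => // [t|].
    by rewrite mule_ge0// lee_fin ltW.
  apply: ae_impl aeall => t [tT [pt gt]].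
  case: (ltgtP t (- T)) tT => // tT _; last first.
    rewrite [loss g _]/loss ifF ?mule0//; apply/negbTE.
    by rewrite -ltNge -ltrBlDr sub0r.
  have t0 : t <= 0 by apply: le_trans (ltW tT) _; rewrite oppr_le0.
  have tT0 : t + T <= 0 by rewrite -lerBrDr sub0r ltW.
  have [vg _] := gt tT0.
  by rewrite /loss t0 tT0 rate_left// -(mulrN r) -EFinM lee_fin maxr_pMr ?mulr0 ?(ltW r0).
have lg0 : (0 <= \int[mu]_t loss g t)%E by exact: integral_ge0.
have gg0 : (0 <= \int[mu]_t gain g t)%E by exact: integral_ge0.
rewrite !costE; apply: (lee_affine_sub r0 gg0 _ (loss_le Wk)) => //.
by rewrite lg0 loss_le.
Qed.

End cost.

(** * The value function *)

Section value.
Context (R : realType) (n : nat) (M : smoothManifold R n) (S : subRiemannian M).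
Variables (L : lagrangian M) (lambda C A : R).
Hypotheses (lambda0 : 0 < lambda) (C0 : 0 <= C) (A0 : 0 <= A).
Hypothesis LC : forall (x : M) (v : tangent x), distr S v -> - C <= L v.
Hypothesis LA : forall (x : M) (v : tangent x), distr S v -> hnorm S v <= 1 ->
  L v <= A.
Notation mu := (@lebesgue_measure R).
Notation u := (value_function S L lambda).

Lemma velocity_cst (x : M) (t : R) :
  has_velocity (cst x : R -> M) t /\ velocity (cst x : R -> M) t = 0 :> 'rV[R]_n.
Proof.
pose q : 'rV[R]_n := cmap (chart_at x) x.
have dq : derivable (cst q : R -> 'rV[R]_n) t 1 by exact: derivable_cst.
have q0 : derive1 (cst q : R -> 'rV[R]_n) t = 0 by rewrite derive1_cst.
by split; [exact: dq|exact: q0].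
Qed.

Lemma W11_neg_cst (x : M) : W11_neg S (cst x).
Proof.
move=> a b ab b0; split; first split.
- by apply: continuous_subspaceT => t; exact: cvg_cst.
- move=> phi _ _ e e0; exists 1 => // m s t _ _ _.
  by rewrite big1// => i _; rewrite /= subrr normr0.
- apply: aeW => t _; have [vx ->] := velocity_cst x t.
  by split=> //; exact: distr0.
Qed.

(** Constant curves have finite cost, and all costs are at least -C / lambda. *)
Lemma value_fin_num (x : M) : u x \is a fin_num.
Proof.
rewrite fin_numElt; apply/andP; split.
  apply: (@lt_le_trans _ _ (- (C / lambda))%:E); first exact: ltNyr.
  apply/ereal_infP => _ [g [Wg _ ->]].
  exact: (cost_ge lambda0 C0 LC Wg).
apply: (@le_lt_trans _ _ (cost L lambda (cst x))).
  by apply: ereal_inf_lbound; exists (cst x); split=> //; exact: W11_neg_cst.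
have -> : cost L lambda (cst x) =
    (\int[mu]_(t in `]-oo, 0%R]) ((L (0 : tangent x))%:E * (expR (lambda * t))%:E))%E.
  apply: eq_integral => t _; rewrite -EFinM mulrC; congr (_ * _)%:E.
  by have [_ ->] := velocity_cst x t.
have inte : mu.-integrable `]-oo, 0%R] (fun t => (expR (lambda * t))%:E).
  apply/integrableP; split.
    by apply/measurable_EFinP; apply: measurable_funTS; apply: measurableT_comp.
  under eq_integral do rewrite gee0_abs ?lee_fin ?expR_ge0//.
  by rewrite integral_discount// ltry.
by rewrite integralZl// integral_discount// -EFinM ltry.
Qed.

Lemma value_ge (x : M) : - (C / lambda) <= fine (u x).
Proof.
rewrite -lee_fin fineK ?value_fin_num//; apply/ereal_infP => _ [g [Wg _ ->]].
exact: (cost_ge lambda0 C0 LC Wg).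
Qed.

Lemma value_append (T : R) (x y : M) p : 0 <= T -> subunit_path S T x y p ->
  fine (u y) <= expR (- lambda * T) * fine (u x) + A * T.
Proof.
move=> T0 pxy; set r := expR _; have r0 : 0 < r by exact: expR_gt0.
have [ux uy] := (fineK (value_fin_num x), fineK (value_fin_num y)).
rewrite -lerBlDr -ler_pdivrMl// -lee_fin ux.
apply/ereal_infP => _ [g [Wg gx ->]].
rewrite EFinM lee_pdivrMl// EFinB leeBlDr// uy.
apply: le_trans (cost_append lambda0 C0 A0 LC LA T0 pxy Wg gx).
apply: ereal_inf_lbound; exists (append T g p); split=> //.
  exact: (W11_append T0 pxy Wg gx).
exact: (append0 T0 pxy gx).
Qed.

(** The two occurrences of lambda, in 1 - exp(-lambda T) <= lambda T and in
    u >= -C / lambda, cancel. *)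
Lemma value_path_le (T : R) (x y : M) p : 0 <= T -> subunit_path S T x y p ->
  fine (u y) - fine (u x) <= (A + C) * T.
Proof.
move=> T0 pxy; have := value_append T0 pxy; set r := expR _ => uy.
have r1 : r <= 1 by rewrite -expR0 ler_expR mulNr oppr_le0 mulr_ge0// ltW.
have rT : 1 - r <= lambda * T.
  by have := expR_ge1Dx (- lambda * T); rewrite -/r; lra.
have h1 : (1 - r) * - fine (u x) <= (1 - r) * (C / lambda).
  by rewrite ler_wpM2l ?subr_ge0// lerNl value_ge.
have h2 : (1 - r) * (C / lambda) <= lambda * T * (C / lambda).
  by rewrite ler_wpM2r// divr_ge0// ltW.
have h3 : lambda * T * (C / lambda) = C * T by field; rewrite gt_eqF.
rewrite h3 in h2; lra.
Qed.

Lemma value_dist_le (T : R) (x y : M) p : 0 <= T -> subunit_path S T x y p ->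
  `|fine (u x) - fine (u y)| <= (A + C) * T.
Proof.
move=> T0 pxy; rewrite ler_distl.
have h1 := value_path_le T0 pxy.
have h2 := value_path_le T0 (subunit_path_rev pxy).
by apply/andP; split; lra.
Qed.

Lemma value_lipschitz (x y : M) :
  (`|u x - u y| <= (A + C + 1)%:E * cc_dist S x y)%E.
Proof.
have K0 : 0 < A + C + 1 by rewrite ltr_wpDl// addr_ge0.
rewrite -(fineK (value_fin_num x)) -(fineK (value_fin_num y)) -EFinB abse_EFin.
set d := `|_|; rewrite -lee_pdivrMl// -EFinM.
apply/ereal_infP => _ [a [b [g [ab Wg ga gb ->]]]].
have [->|] := eqVneq (curve_length S a b g) +oo%E; first by rewrite leey.
rewrite -ltey => lfin; apply/lee_addgt0Pr => e e0.
have ba0 : 0 < b - a + 1 by rewrite ltr_wpDl// subr_ge0.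
have e'0 : 0 < e / (b - a + 1) by exact: divr_gt0.
have [T [p [T0 pxy Tl]]] := subunit_path_of_curve ab e'0 Wg lfin.
rewrite ga gb in pxy.
apply: (@le_trans _ _ T%:E).
  rewrite lee_fin ler_pdivrMl//; apply: le_trans (value_dist_le T0 pxy) _.
  by rewrite ler_wpM2r// lerDl.
apply: le_trans Tl _; rewrite leeD2l// lee_fin.
by rewrite mulrAC ler_pdivrMr// ler_pM2l// lerDl.
Qed.

End value.

Theorem proposition3 (R : realType) (n : nat) (M : smoothManifold R n)
    (S : subRiemannian M) (L : lagrangian M) :
  lagrangian_C2 S L ->
  uniformly_superlinear S L ->
  uniformly_bounded S L ->
  strictly_convex S L ->
  exists K : R, forall (lambda : R) (x y : M), 0 < lambda ->
    (`|value_function S L lambda x - value_function S L lambda y|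
       <= K%:E * cc_dist S x y)%E.
Proof.
move=> _ superL boundL _.
have [c cL] := superL 0 (lexx 0).
have [A A0 LA] : exists2 A, 0 <= A &
    forall (x : M) (v : tangent x), distr S v -> hnorm S v <= 1 -> L x v <= A.
  have := boundL 1 ler01; set s := ereal_sup _ => sfin.
  exists (Num.max (fine s) 0); first by rewrite le_max lexx orbT.
  move=> x v Dv v1; rewrite le_max; apply/orP; left.
  have : ((L x v)%:E <= s)%E by apply: ereal_sup_ubound; exists x, v.
  by case: s sfin => // r _; rewrite lee_fin.
exists (A + `|c| + 1) => lambda x y lambda0.
apply: value_lipschitz => // z v Dv.
have := cL z v Dv; rewrite mul0r add0r; apply: le_trans.
by rewrite lerNl -normrN ler_norm.
Qed.
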